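(* Let $n\ge 3$ and let $\lambda=\{\lambda_0<\lambda_1<\dots<\lambda_n\}$ be a set of distinct real numbers. Then the orbit space $Q_n=M_{\mathrm{St}_n,\lambda}/T^n$ is not a simple polytope, and hence $M_{\mathrm{St}_n,\lambda}$ (with this $T^n$-action) is not a quasitoric manifold.
   Context: Rows and columns are indexed by $0,1,\dots,n$. A Hermitian arrow matrix is a Hermitian $(n+1)\times(n+1)$-matrix whose entries vanish outside the main diagonal, the row $0$ and the column $0$. $M_{\mathrm{St}_n,\lambda}$ is the smooth $2n$-manifold of Hermitian arrow matrices with spectrum $\lambda$. The torus $T^{n+1}$ of diagonal unitary matrices acts on it by conjugation, scalar matrices act trivially, and this gives a locally standard action of $T^n=T^{n+1}/\Delta(T^1)$, so that $Q_n$ is a manifold with corners. A quasitoric manifold is a smooth closed $2n$-manifold with a locally standard $T^n$-action whose orbit space is, as a manifold with corners, a simple polytope. *)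

(* Defs.v *)
From HB Require Import structures.
From mathcomp Require Import all_boot all_order all_algebra.
From mathcomp Require Import all_classical all_reals all_analysis.
From mathcomp Require Import complex.

Set Implicit Arguments.
Unset Strict Implicit.
Unset Printing Implicit Defensive.

Import Order.TTheory GRing.Theory Num.Theory.
Import numFieldNormedType.Exports.

Local Open Scope classical_set_scope.
Local Open Scope ring_scope.
Local Open Scope quotient_scope.

(* The usual topology of the complex numbers. *)
HB.instance Definition _ (R : realType) := NormedModule.copy R[i] R[i]^o.

(* Smooth maps between arbitrary subsets of normed spaces: a map is smooth on  *)
(* a subset when it extends, near each point of it, to a C^oo map on an open   *)
(* set.  The spaces used below are finite-dimensional, where C^k means that    *)
(* all iterated directional derivatives of order at most k exist and are       *)
(* continuous.                                                                 *)
Section Smooth.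
Context {R : realType} {E F : normedModType R}.

Fixpoint Ck (k : nat) (U : set E) (f : E -> F) : Prop :=
  {in U, continuous f} /\
  if k is k'.+1 then
    forall v : E, {in U, forall x, derivable f x v} /\
      Ck k' U (fun x => 'D_v f x)
  else True.

Definition smooth_on (A : set E) (f : E -> F) : Prop :=
  forall x, A x -> exists (U : set E) (g : E -> F),
    [/\ open U, U x, (forall k, Ck k U g) & {in A `&` U, f =1 g}].
End Smooth.

Definition diffeo {R : realType} {E F : normedModType R}
    (A : set E) (B : set F) (f : E -> F) : Prop :=
  exists g : F -> E,
    [/\ (forall x, A x -> B (f x) /\ g (f x) = x),
        (forall y, B y -> A (g y) /\ f (g y) = y),
        smooth_on A f & smooth_on B g].

(* 'M[R[i]]_(p, q) is a normed module over R[i] only; these maps identify it   *)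
(* with the real normed module of pairs (real part, imaginary part).           *)
Definition realify {R : realType} {p q : nat} (A : 'M[R[i]]_(p, q)) :
    'M[R]_(p, q) * 'M[R]_(p, q) :=
  (map_mx (@complex.Re R) A, map_mx (@complex.Im R) A).

Definition complexify {R : realType} {p q : nat}
    (A : 'M[R]_(p, q) * 'M[R]_(p, q)) : 'M[R[i]]_(p, q) :=
  \matrix_(j, k) Complex (A.1 j k) (A.2 j k).

Definition complex_diffeo {R : realType} {p q p' q' : nat}
    (A : set 'M[R[i]]_(p, q)) (B : set 'M[R[i]]_(p', q'))
    (f : 'M[R[i]]_(p, q) -> 'M[R[i]]_(p', q')) : Prop :=
  diffeo (realify @` A) (realify @` B) (realify \o f \o complexify).

(* Smooth manifolds are submanifolds of a space of complex matrices, with the  *)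
(* smooth structure induced by the ambient space.                              *)
Definition smooth_manifold {R : realType} {p q : nat} (d : nat)
    (X : set 'M[R[i]]_(p, q)) : Prop :=
  forall x : X, exists (U : set X) (V : set 'rV[R]_d)
      (phi : 'M[R]_(p, q) * 'M[R]_(p, q) -> 'rV[R]_d),
    [/\ open U, U x, open V & diffeo (realify @` (set_val @` U)) V phi].

(* A manifold with corners of dimension n is modelled on R_{>=0}^n; the        *)
(* coordinate changes are homeomorphisms preserving the codimension, i.e. the  *)
(* number of vanishing coordinates.  A chart is given by its domain and a      *)
(* total map, only the values of which on the domain matter.                   *)
Section Corners.
Context {R : realType} (n : nat).

Definition orthant : set 'rV[R]_n :=
  [set v : 'rV[R]_n | forall i, 0 <= v 0 i].

Definition codim (v : 'rV[R]_n) : nat := #|[pred i | v 0 i == 0]|.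

Definition corner_chart {Q : topologicalType}
    (c : set Q * (Q -> 'rV[R]_n)) : Prop :=
  [/\ open c.1,
      {in c.1 &, injective c.2},
      {in c.1, continuous c.2} &
      forall V : set Q, open V -> V `<=` c.1 ->
        exists2 W : set 'rV[R]_n, open W & c.2 @` V = W `&` orthant].

Definition corner_atlas (Q : topologicalType) :=
  set (set Q * (Q -> 'rV[R]_n)).

Definition manifold_with_corners {Q : topologicalType}
    (A : corner_atlas Q) : Prop :=
  [/\ hausdorff_space Q, @second_countable Q,
      (forall c, A c -> corner_chart c),
      (forall x, exists2 c, A c & c.1 x) &
      forall c c', A c -> A c' ->
        {in c.1 `&` c'.1, forall x, codim (c.2 x) = codim (c'.2 x)}].

Definition corner_homeo {Q Q' : topologicalType}
    (A : corner_atlas Q) (A' : corner_atlas Q') (f : Q -> Q') : Prop :=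
  [/\ continuous f,
      (exists2 g : Q' -> Q, cancel f g /\ cancel g f & continuous g) &
      forall c c' x, A c -> A' c' -> c.1 x -> c'.1 (f x) ->
        codim (c.2 x) = codim (c'.2 (f x))].
End Corners.

Arguments orthant {R} n.

Section Polytopes.
Context {R : realType} {n : nat}.

(* The k+1 rows of a matrix are affinely independent when they become linearly *)
(* independent once a coordinate 1 is prepended.                               *)
Definition contains_simplex (k : nat) (F : set 'rV[R]_n) : Prop :=
  exists2 p : 'M[R]_(k.+1, n),
    (forall i, F (row i p)) & row_free (row_mx (const_mx 1 : 'cV[R]_k.+1) p).

Definition affine_dim (k : nat) (F : set 'rV[R]_n) : Prop :=
  contains_simplex k F /\ ~ contains_simplex k.+1 F.

(* Polytopes of dimension n are taken full-dimensional in R^n.                 *)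
Definition polytope (P : set 'rV[R]_n) : Prop :=
  [/\ exists (m : nat) (L : 'M[R]_(n, m)) (b : 'rV[R]_m),
        P = [set x : 'rV[R]_n | forall i, 0 <= (x *m L + b) 0 i],
      bounded_set P & affine_dim n P].

Definition face (P F : set 'rV[R]_n) : Prop :=
  exists (l : 'cV[R]_n) (b : R),
    (forall x, P x -> 0 <= (x *m l) 0 0 + b) /\
    F = [set x : 'rV[R]_n | P x /\ (x *m l) 0 0 + b = 0].

Definition facet (P F : set 'rV[R]_n) : Prop := face P F /\ affine_dim n.-1 F.

Definition vertex (P : set 'rV[R]_n) (v : 'rV[R]_n) : Prop := face P [set v].

Definition simple_polytope (P : set 'rV[R]_n) : Prop :=
  polytope P /\
  forall v, vertex P v -> ([set F | facet P F /\ F v] #= `I_n)%card.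

(* For a simple polytope the restrictions of affine maps contain a chart around *)
(* each point, in which the facets become the coordinate hyperplanes.          *)
Definition polytope_atlas (P : set 'rV[R]_n) : corner_atlas n P :=
  [set c : set P * (P -> 'rV[R]_n) | corner_chart c /\
     exists (L : 'M[R]_n) (b : 'rV[R]_n),
       forall x, c.1 x -> c.2 x = set_val x *m L + b].

Arguments polytope_atlas P : clear implicits.

Definition is_simple_polytope {Q : topologicalType}
    (A : corner_atlas (R := R) n Q) : Prop :=
  manifold_with_corners A /\
  exists (P : set 'rV[R]_n) (f : Q -> P),
    simple_polytope P /\ corner_homeo A (polytope_atlas P) f.
End Polytopes.

Arguments polytope_atlas {R n} P _.

Definition torus {R : realType} (n : nat) : set 'rV[R[i]]_n :=
  [set t : 'rV[R[i]]_n | forall j, `|t 0 j| = 1].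
Arguments torus {R} n.

Definition torus_mul {R : realType} {n : nat} (s t : 'rV[R[i]]_n) :
    'rV[R[i]]_n := map2_mx *%R s t.

Record torus_action {R : realType} (n : nat) {E : topologicalType}
    (X : set E) := TorusAction {
  tact :> 'rV[R[i]]_n -> E -> E;
  tact_stable : forall t x, torus n t -> X x -> X (tact t x);
  tact1 : forall x, X x -> tact (const_mx 1) x = x;
  tactM : forall s t x, torus n s -> torus n t -> X x ->
    tact (torus_mul s t) x = tact s (tact t x);
  tact_continuous : {within torus n `*` X,
    continuous (fun tx : 'rV[R[i]]_n * E => tact tx.1 tx.2)} }.

Section OrbitSpace.
Context {R : realType} {n : nat} {E : topologicalType} {X : set E}.
Variable act : torus_action (R := R) n X.

Definition orbit_rel : rel X := fun x y =>
  `[< exists2 t, torus n t & act t (set_val x) = set_val y >].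

Lemma torus_mulV (t : 'rV[R[i]]_n) : torus n t ->
  torus n (map_mx GRing.inv t) /\ torus_mul (map_mx GRing.inv t) t = const_mx 1.
Proof.
move=> Tt; split=> [j|]; first by rewrite mxE normfV Tt invr1.
apply/rowP => j; rewrite !mxE mulVf// -normr_eq0 Tt; exact: oner_neq0.
Qed.

Lemma orbit_rel_refl : reflexive orbit_rel.
Proof.
move=> x; apply/asboolP; exists (const_mx 1); last by rewrite tact1//; exact: set_valP.
by move=> j; rewrite mxE normr1.
Qed.

Lemma orbit_rel_sym : symmetric orbit_rel.
Proof.
suff S x y : orbit_rel x y -> orbit_rel y x.
  by move=> x y; apply/idP/idP; exact: S.
move=> /asboolP[t Tt e]; apply/asboolP.
have [Tt' e'] := torus_mulV Tt.
exists (map_mx GRing.inv t) => //.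
by rewrite -e -tactM ?e' ?tact1//; exact: set_valP.
Qed.

Lemma orbit_rel_trans : transitive orbit_rel.
Proof.
move=> y x z /asboolP[s Ts e] /asboolP[t Tt e']; apply/asboolP.
exists (torus_mul t s); first by move=> j; rewrite mxE normrM Tt Ts mulr1.
by rewrite tactM ?e ?e'//; exact: set_valP.
Qed.

Canonical orbit_equiv :=
  EquivRel orbit_rel orbit_rel_refl orbit_rel_sym orbit_rel_trans.

Definition orbit_space : topologicalType :=
  quotient_topology {eq_quot orbit_equiv}.

Definition orbit_proj (x : X) : orbit_space :=
  \pi_(quotient_topology {eq_quot orbit_equiv}) x.

End OrbitSpace.

Section LocallyStandard.
Context {R : realType} {n p q : nat} {X : set 'M[R[i]]_(p, q)}.
Variable act : torus_action (R := R) n X.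

(* Bijective continuous homomorphisms of the compact group T^n: the inverse is *)
(* automatically continuous.                                                   *)
Definition torus_automorphism (psi : 'rV[R[i]]_n -> 'rV[R[i]]_n) : Prop :=
  [/\ set_bij (torus n) (torus n) psi,
      {in torus n &, {morph psi : s t / torus_mul s t}} &
      {within torus n, continuous psi}].

(* A weakly equivariant diffeomorphism of an invariant open subset onto an     *)
(* open subset of C^n, on which T^n acts coordinatewise.                       *)
Definition standard_chart (U : set X)
    (phi : 'M[R[i]]_(p, q) -> 'rV[R[i]]_n) : Prop :=
  [/\ open U,
      (forall x y : X, U x -> orbit_rel act x y -> U y),
      (exists2 V : set 'rV[R[i]]_n, open V &
         complex_diffeo (set_val @` U) V phi) &
      exists2 psi, torus_automorphism psi &
        forall t (x : X), torus n t -> U x ->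
          phi (act t (set_val x)) = torus_mul (psi t) (phi (set_val x))].

Definition locally_standard : Prop :=
  forall x : X, exists U phi, standard_chart U phi /\ U x.

(* The manifold-with-corners structure of the orbit space is induced from the  *)
(* standard charts through C^n / T^n = R_{>=0}^n, z |-> (|z_1|, ..., |z_n|).   *)
Definition orbit_atlas : corner_atlas (R := R) n (orbit_space act) :=
  [set c | exists U phi,
     [/\ standard_chart U phi, c.1 = orbit_proj act @` U &
         forall x, U x ->
           c.2 (orbit_proj act x) =
           \row_j complex.Re `|phi (set_val x) 0 j| ]].

Definition quasitoric : Prop :=
  [/\ smooth_manifold (2 * n) X, compact X, locally_standard &
      is_simple_polytope orbit_atlas].

End LocallyStandard.

Arguments orbit_atlas {R n p q X} act _.
Arguments quasitoric {R n p q X} act.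

Section ArrowMatrices.
Context {R : realType} {n : nat}.
Local Notation C := R[i].

Definition arrow (A : 'M[C]_n.+1) : Prop :=
  forall i j : 'I_n.+1, i != j -> i != 0 -> j != 0 -> A i j = 0.

Definition has_spectrum (lambda : 'I_n.+1 -> R) (A : 'M[C]_n.+1) : Prop :=
  forall z : C, eigenvalue A z <-> exists i, z = (lambda i)%:C%C.

Definition isospectral_arrow (lambda : 'I_n.+1 -> R) : set 'M[C]_n.+1 :=
  [set A : 'M[C]_n.+1 | [/\ A \is hermsymmx, arrow A & has_spectrum lambda A]].

Definition diag_conj (t : 'rV[C]_n.+1) (A : 'M[C]_n.+1) : 'M[C]_n.+1 :=
  diag_mx t *m A *m invmx (diag_mx t).

(* T^n = T^{n+1} / Delta(T^1): the class of (t_0, ..., t_n) has the unique     *)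
(* representative (1, t_1 / t_0, ..., t_n / t_0) (lemma torus_quotient), and   *)
(* scalar matrices act trivially (lemma diag_conj_scale).                      *)
Definition torus_section (t : 'rV[C]_n) : 'rV[C]_n.+1 :=
  row_mx (const_mx 1 : 'rV[C]_1) t.

Lemma torus_sectionE (t : 'rV[C]_n) :
  torus_section t 0 0 = 1 /\ forall j, torus_section t 0 (lift 0 j) = t 0 j.
Proof.
split=> [|j].
  have -> : (0 : 'I_n.+1) = lshift n (0 : 'I_1) by apply/val_inj.
  by rewrite [LHS](row_mxEl (const_mx 1) t) mxE.
have -> : lift 0 j = rshift 1 j :> 'I_n.+1 by apply/val_inj.
exact: (row_mxEr (const_mx 1) t).
Qed.

Lemma torus_quotient (t : 'rV[C]_n.+1) : torus n.+1 t ->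
  exists! s, torus n s /\ exists2 c : C, `|c| = 1 & t = c *: torus_section s.
Proof.
move=> Tt; have t0 : t 0 0 != 0 by rewrite -normr_eq0 Tt; exact: oner_neq0.
exists (\row_j (t 0 (lift 0 j) / t 0 0)); split.
  split=> [j|]; first by rewrite mxE normf_div !Tt divr1.
  exists (t 0 0) => //; apply/rowP => j; rewrite mxE.
  have [e0 eS] := torus_sectionE (\row_j (t 0 (lift 0 j) / t 0 0)).
  case: (unliftP 0 j) => [k ->|->]; last by rewrite e0 mulr1.
  by rewrite eS mxE mulrC divfK.
move=> s [Ts [c c1 e]]; have [e0 eS] := torus_sectionE s.
have tc : t 0 0 = c by rewrite e mxE e0 mulr1.
apply/rowP => j; rewrite mxE tc e mxE eS mulrC mulKf//.
by rewrite -tc.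
Qed.

Lemma diag_mx_inv (t : 'rV[C]_n.+1) : torus n.+1 t ->
  diag_mx t \in unitmx /\ invmx (diag_mx t) = diag_mx (map_mx GRing.inv t).
Proof.
move=> Tt.
have e : diag_mx t *m diag_mx (map_mx GRing.inv t) = 1%:M.
  rewrite mulmx_diag -diag_const_mx; congr diag_mx; apply/rowP => j.
  by rewrite !mxE divff// -normr_eq0 Tt; exact: oner_neq0.
have [u _] := mulmx1_unit e; split=> //.
by rewrite -[RHS]mul1mx -(mulVmx u) -mulmxA e mulmx1.
Qed.

Lemma diag_conjE (t : 'rV[C]_n.+1) A i j : torus n.+1 t ->
  diag_conj t A i j = t 0 i * A i j / t 0 j.
Proof.
move=> Tt; rewrite /diag_conj (diag_mx_inv Tt).2 mul_mx_diag mxE.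
by rewrite mul_diag_mx !mxE.
Qed.

Lemma diag_conj_scale (c : C) (t : 'rV[C]_n.+1) A :
  `|c| = 1 -> torus n.+1 t -> diag_conj (c *: t) A = diag_conj t A.
Proof.
move=> c1 Tt; have c0 : c != 0 by rewrite -normr_eq0 c1; exact: oner_neq0.
apply/matrixP => i j; rewrite !diag_conjE//.
  by rewrite !mxE -[c * _ * _]mulrA -mulf_div divff// mul1r.
by move=> k; rewrite mxE normrM c1 Tt mulr1.
Qed.

Lemma torus_section_torus t : torus n t -> torus n.+1 (torus_section t).
Proof.
move=> Tt j; have [e0 eS] := torus_sectionE t.
by case: (unliftP 0 j) => [k ->|->]; rewrite ?eS ?e0 ?normr1.
Qed.

Lemma diag_conj_stable lambda t A : torus n.+1 t ->
  isospectral_arrow lambda A -> isospectral_arrow lambda (diag_conj t A).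
Proof.
move=> Tt [hA aA sA]; have t0 j : t 0 j != 0.
  by rewrite -normr_eq0 Tt; exact: oner_neq0.
split.
- apply/is_hermitianmxP; rewrite expr0 scale1r; apply/matrixP => i j.
  have eA : A i j = (A j i)^*.
    move/is_hermitianmxP: hA; rewrite expr0 scale1r => /matrixP/(_ i j) ->.
    by rewrite !mxE.
  transitivity (diag_conj t A j i)^*; last by rewrite [RHS]mxE [_^T _ _]mxE.
  rewrite !diag_conjE// eA !rmorphM fmorphV /=.
  have e k : (t 0 k)^* = (t 0 k)^-1.
    by rewrite invC_norm Tt expr1n invr1 mul1r.
  rewrite -[X in _ = _ / X]/((t 0 i)^*) !e invrK.
  by rewrite [RHS]mulrC [_^-1 * _]mulrC mulrA.
- by move=> i j ij i0 j0; rewrite diag_conjE// aA// mulr0 mul0r.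
- move=> z; rewrite -sA.
  have [u _] := diag_mx_inv Tt.
  split=> /eigenvalueP[v ev v0]; apply/eigenvalueP.
    exists (v *m diag_mx t).
      rewrite scalemxAl -ev /diag_conj !mulmxA mulmxKV//.
    by apply: contraNneq v0 => e; rewrite -(mulmxK u v) e mul0mx.
  exists (v *m invmx (diag_mx t)).
    by rewrite /diag_conj !mulmxA mulmxKV// ev scalemxAl.
  by apply: contraNneq v0 => e; rewrite -(mulmxKV u v) e mul0mx.
Qed.

Definition arrow_act (t : 'rV[C]_n) : 'M[C]_n.+1 -> 'M[C]_n.+1 :=
  diag_conj (torus_section t).

Lemma arrow_act_stable lambda t A : torus n t ->
  isospectral_arrow lambda A -> isospectral_arrow lambda (arrow_act t A).
Proof. by move=> Tt; exact/diag_conj_stable/torus_section_torus. Qed.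

Lemma arrow_act1 A : arrow_act (const_mx 1) A = A.
Proof.
rewrite /arrow_act; have -> : torus_section (const_mx 1) = const_mx 1.
  apply/rowP => j; rewrite [RHS]mxE; have [e0 eS] := torus_sectionE (const_mx 1).
  by case: (unliftP 0 j) => [k ->|->]; rewrite ?eS ?e0 ?mxE.
apply/matrixP => i j; rewrite diag_conjE; last by move=> k; rewrite mxE normr1.
by rewrite !mxE mul1r divr1.
Qed.

Lemma arrow_actM s t A : torus n s -> torus n t ->
  arrow_act (torus_mul s t) A = arrow_act s (arrow_act t A).
Proof.
move=> Ts Tt; have Tst : torus n (torus_mul s t).
  by move=> j; rewrite mxE normrM Ts Tt mulr1.
have e k : torus_section (torus_mul s t) 0 k =
           torus_section s 0 k * torus_section t 0 k.
  have [e0 eS] := torus_sectionE (torus_mul s t).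
  have [s0 sS] := torus_sectionE s; have [t0 tS] := torus_sectionE t.
  case: (unliftP 0 k) => [l ->|->]; last by rewrite e0 s0 t0 mulr1.
  by rewrite eS sS tS mxE.
apply/matrixP => i j; rewrite /arrow_act !diag_conjE//;
  try exact: torus_section_torus.
by rewrite !e invfM !mulrA mulrAC.
Qed.

Lemma arrow_act_continuous (X : set 'M[C]_n.+1) : {within torus n `*` X,
  continuous (fun tA : 'rV[C]_n * 'M[C]_n.+1 => arrow_act tA.1 tA.2)}.
Proof.
apply: (@subspace_eq_continuous _ _ _ (fun tA : 'rV[C]_n * 'M[C]_n.+1 =>
    \matrix_(i, j) (torus_section tA.1 0 i * tA.2 i j / torus_section tA.1 0 j))).
  move=> [t A]; rewrite inE => -[Tt _]; apply/matrixP => i j.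
  by rewrite mxE diag_conjE//; exact: torus_section_torus.
apply: continuous_in_subspaceT => -[t A]; rewrite inE => -[/= Tt _].
have t0 k : torus_section t 0 k != 0.
  by rewrite -normr_eq0 torus_section_torus//; exact: oner_neq0.
have cs k : (fun tA : 'rV[C]_n * 'M[C]_n.+1 => torus_section tA.1 0 k) @ (t, A)
    --> torus_section t 0 k.
  have [e0 eS] := torus_sectionE t; case: (unliftP 0 k) => [l ->|->].
    rewrite eS.
    rewrite (_ : (fun _ => _) = fun tA : 'rV[C]_n * 'M[C]_n.+1 => tA.1 0 l).
      by apply: (cvg_comp _ (fun u : 'rV[C]_n => u 0 l) cvg_fst); exact: coord_continuous.
    by apply/funext => tA; rewrite (torus_sectionE _).2.
  rewrite e0 (_ : (fun _ => _) = cst 1); first exact: cvg_cst.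
  by apply/funext => tA; rewrite (torus_sectionE _).1.
have cm i j : (fun tA : 'rV[C]_n * 'M[C]_n.+1 =>
      torus_section tA.1 0 i * tA.2 i j / torus_section tA.1 0 j) @ (t, A) -->
    torus_section t 0 i * A i j / torus_section t 0 j.
  apply: cvgM; last exact: cvgV (t0 j) (cs j).
  apply: cvgM; first exact: cs.
  by apply: (cvg_comp _ (fun B : 'M[C]_n.+1 => B i j) cvg_snd); exact: coord_continuous.
apply/cvg_ballP => e e_gt0; near=> tA; split=> // i j; rewrite [_ i j]mxE [X in ball _ _ X]mxE.
move: i j; near: tA; apply: filter_forall => i; apply: filter_forall => j.
exact: (@cvg_ball _ _ _ _ _ _ _ (cm i j) e e_gt0).
Unshelve. all: by end_near. Qed.

Definition arrow_action (lambda : 'I_n.+1 -> R) :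
    torus_action (R := R) n (isospectral_arrow lambda) :=
  TorusAction (@arrow_act_stable lambda) (fun A _ => arrow_act1 A)
    (fun s t A Ts Tt _ => arrow_actM A Ts Tt)
    (@arrow_act_continuous (isospectral_arrow lambda)).

End ArrowMatrices.

(* Main.v *)
Require Import Defs.
From mathcomp Require Import all_boot all_order all_algebra all_fingroup.
From mathcomp Require Import all_classical all_reals all_analysis.
From mathcomp Require Import complex ring lra zify.

Set Implicit Arguments.
Unset Strict Implicit.
Unset Printing Implicit Defensive.

Import Order.TTheory GRing.Theory Num.Theory.
Import numFieldNormedType.Exports.

Local Open Scope classical_set_scope.
Local Open Scope ring_scope.

(** The strata of the orbit space [Q] are known explicitly.  The codimension of the orbit of an
    arrow matrix is the number of its vanishing off-diagonal entries (legs)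
    ([orbit_chart_codim]), so that the codimension [n] points are the diagonal
    matrices, one for each permutation of the spectrum.  One nonzero leg [i]
    gives an open edge of [Q], which joins a permutation [s] to
    [s] composed with the transposition of [0] and [i]; two nonzero legs [i] and
    [j] give an open 2-face with six vertices, a hexagon.

    Keep the eigenvalues outside four positions fixed.  There remain 24 vertices,
    labelled by the permutations of four letters, with three edges [i = 1, 2, 3]
    at each of them, and 12 hexagons [{s | s k = l}].  Suppose that they are the
    vertices, edges and 2-faces of a simple polytope.  A generic linear functional
    orients the edges, and on a convex polygon it has one local minimum and one
    local maximum, so that at most 24 pairs (hexagon, vertex of it) consist of a
    local extremum of the hexagon.  At each vertex two of the three edges point
    in the same direction, which gives at least one such pair for each vertex, and
    three pairs for the global minimum: at least 26 pairs, a contradiction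
    ([no_hexagonal_sphere]).  This is an elementary form of the remark that 24
    vertices, 36 edges and 12 hexagons form a torus and not a sphere.

    The homeomorphism onto the polytope only preserves codimensions, so the
    faces have to be recovered from it.  At a vertex of a simple polytope the
    local cone is simplicial ([simple_frame]), which yields affine charts
    ([frame_chart_atlas]).  A constraint that vanishes at one point of a curve of
    constant codimension vanishes along the whole curve, hence at its endpoints
    ([active_path]).  It is therefore enough to connect the vertices of an edge
    ([path_edge]) or of a hexagon ([path_hex]) to a common point of the open face
    by explicit curves of arrow matrices.  Then the hexagon lies in the cone
    spanned by the two edges at any of its vertices ([vertex_cone], [vtx_cone]),
    which is all the convexity that the count uses. *)

(** * An acyclic orientation of the star graph on S_4 *)

(** The neighbour of [s] along the edge [i] of the star graph. *)
Definition flip (s : {perm 'I_4}) (i : 'I_4) : {perm 'I_4} := (tperm ord0 i * s)%g.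

Lemma flipE s i a : flip s i a = s (tperm ord0 i a).
Proof. by rewrite /flip permM. Qed.

(** The vertices at which both edges of their hexagon [{t | t k = s k}] go up
    for [lt]. *)
Definition hexagon_source (lt : rel {perm 'I_4}) (k : 'I_4) :=
  [set s | [forall i, (i != ord0) ==> (i != k) ==> lt s (flip s i)]]%SET.

(** The hypothesis says that a source of a hexagon lies strictly below the rest of
    it, so a hexagon has at most one source; the four hexagons with index [k] are
    told apart by the value [s k]. *)
Lemma card_hexagon_source (lt : rel {perm 'I_4}) (k : 'I_4) :
  (forall s t, lt s t -> ~~ lt t s) ->
  (forall s t : {perm 'I_4}, s k = t k -> s != t ->
     (forall i, i != ord0 -> i != k -> lt s (flip s i)) -> lt s t) ->
  (#|hexagon_source lt k| <= 4)%N.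
Proof.
move=> asym H; rewrite -[X in (_ <= X)%N](card_ord 4).
have src s : s \in hexagon_source lt k ->
    forall i, i != ord0 -> i != k -> lt s (flip s i).
  by rewrite inE => /forallP h i i0 ik; move: (h i); rewrite i0 ik.
apply: (@leq_card_in _ _ (fun s : {perm 'I_4} => s k)) => s t /src hs /src ht st.
apply: contraTeq isT => nst.
have := H _ _ (esym st) _ ht; rewrite eq_sym => /(_ nst) lt_ts.
by have := asym _ _ (H _ _ st nst hs); rewrite lt_ts.
Qed.

(** The sign [e] treats local minima and local maxima of the hexagons at once.  For
    each [k] there are at most four hexagon minima and four hexagon maxima, 24 in
    total.  Conversely a vertex is a local extremum of at least one of its three
    hexagons, and of all three if its edges all go up, as at the global minimum. *)
Lemma no_hexagonal_sphere (R : realDomainType) (g : {perm 'I_4} -> R) :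
  (forall s i, i != ord0 -> g (flip s i) != g s) ->
  (forall (e : bool) k (s t : {perm 'I_4}), k != ord0 -> s k = t k -> s != t ->
     (forall i, i != ord0 -> i != k -> 0 < (-1) ^+ e * (g (flip s i) - g s)) ->
     0 < (-1) ^+ e * (g t - g s)) -> False.
Proof.
move=> gne H.
pose lt (e : bool) : rel {perm 'I_4} := fun s t => 0 < (-1) ^+ e * (g t - g s).
have le4 (e : bool) k : k != ord0 -> (#|hexagon_source (lt e) k| <= 4)%N.
  move=> k0; apply: card_hexagon_source => [s t|s t st nst hs]; last exact: H hs.
  by rewrite /lt => h; rewrite -leNgt -[g s - g t]opprB mulrN oppr_le0 ltW.
pose src (e : bool) k s : bool := s \in hexagon_source (lt e) k.
(* the number of hexagons of which s is a local extremum *)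
pose w s := (\sum_(k | k != ord0 :> 'I_4) (src false k s + src true k s))%N.
have sum_w : (\sum_s w s <= 24)%N.
  rewrite exchange_big /=.
  have -> : 24%N = (\sum_(k | k != ord0 :> 'I_4) 8)%N.
    by rewrite sum_nat_const cardC1 card_ord.
  apply: leq_sum => k k0; rewrite big_split /= -!big_mkcond /= !sum1dep_card.
  rewrite -[8%N]/(4 + 4)%N; apply: leq_add;
    [apply: leq_trans (le4 false k k0)|apply: leq_trans (le4 true k k0)];
    by apply: subset_leq_card; apply/fintype.subsetP => s; rewrite inE.
have upE e s i : i != ord0 -> lt e s (flip s i) = (e != (g s < g (flip s i))).
  move=> i0; rewrite /lt; have := gne s i i0.
  case: e; rewrite ?expr1 ?expr0 ?mul1r ?mulN1r ?oppr_gt0 ?subr_lt0 ?subr_gt0.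
  - by case: ltgtP.
  - by case: (_ < _).
pose u s i := g s < g (flip s i).
have srcE e k s : src e k s = [forall i, (i != ord0) ==> (i != k) ==> (e != u s i)].
  rewrite /src inE; apply: eq_forallb => i.
  by case: eqVneq => //= i0; rewrite upE.
have all4 (P : pred 'I_4) : [forall i, P i] =
    [&& P ord0, P (@Ordinal 4 1 isT), P (@Ordinal 4 2 isT) & P (@Ordinal 4 3 isT)].
  apply/forallP/and4P => [h|[h0 h1 h2 h3] [[|[|[|[|]]]] // hi]]; first by split; exact: h.
  - by rewrite (_ : Ordinal hi = ord0) //; apply/val_inj.
  - by rewrite (_ : Ordinal hi = Ordinal (isT : 1 < 4)%N) //; apply/val_inj.
  - by rewrite (_ : Ordinal hi = Ordinal (isT : 2 < 4)%N) //; apply/val_inj.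
  - by rewrite (_ : Ordinal hi = Ordinal (isT : 3 < 4)%N) //; apply/val_inj.
have wE s : w s = (let: (a, b, c) :=
      (u s (@Ordinal 4 1 isT), u s (@Ordinal 4 2 isT), u s (@Ordinal 4 3 isT))
    in (a && b) + (b && c) + (a && c) + (~~ a && ~~ b) + (~~ b && ~~ c) + (~~ a && ~~ c))%N.
  rewrite /w big_mkcond /= !big_ord_recl big_ord0 /= !srcE !all4 /=.
  by do 3 case: (u s _).
have w1 s : (1 <= w s)%N by rewrite wE; do 3 case: (u s _).
have [s0 _ s0min] := arg_minP (P := predT) g (erefl : predT (1%g : {perm 'I_4})).
have w3 : w s0 = 3%N.
  have us0 i : i != ord0 -> u s0 i by move=> i0; rewrite /u lt_neqAle eq_sym gne //= s0min.
  by rewrite wE !us0.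
have : (\sum_s w s >= \sum_(s : {perm 'I_4}) (1 + (s == s0).*2))%N.
  apply: leq_sum => s _; case: eqP => [->|_]; rewrite ?w3 //=; exact: w1.
rewrite big_split /= sum1_card card_Sn (bigD1 s0) //= eqxx big1 => [|s /negPf -> //].
by move/(leq_trans)/(_ sum_w).
Qed.

(** * Continuity of matrix-valued maps *)

Lemma continuous_mx (T : topologicalType) (K : numFieldType) p q
    (f : T -> 'M[K]_(p, q)) :
  (forall i j, continuous (fun x => f x i j)) -> continuous f.
Proof.
move=> cf x; apply/cvg_ballP => e e0; near=> y; split=> // i j.
move: i j; near: y; apply: filter_forall => i; apply: filter_forall => j.
exact: (@cvg_ball _ _ _ _ _ _ _ (cf i j x) e e0).
Unshelve. all: by end_near. Qed.

Lemma continuous_sumr (T : topologicalType) (R : realType) (I : Type) (s : seq I)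
    (f : I -> T -> R) :
  (forall i, continuous (f i)) -> continuous (fun x => \sum_(i <- s) f i x).
Proof.
move=> cf x; elim: s => [|i s IH].
  by under eq_fun do rewrite big_nil; exact: cvg_cst.
under eq_fun do rewrite big_cons.
by apply: cvgD => //; exact: cf.
Qed.

Lemma continuous_mulmxr (R : realType) p q r (A : 'M[R]_(q, r)) :
  continuous (fun x : 'M[R]_(p, q) => x *m A).
Proof.
apply: continuous_mx => i j.
under eq_fun do rewrite mxE.
apply: continuous_sumr => k x; apply: continuousM; last exact: cst_continuous.
exact: coord_continuous.
Qed.

Lemma continuous_real_complex (R : realType) : continuous (fun x : R => (x%:C)%C : R[i]).
Proof.
move=> x; apply/cvgrPdist_lt => e e0.
have e1 : e = ((complex.Re e)%:C)%C.
  by move: e0; case: e => a b /=; rewrite ltcE /= => /andP[/eqP -> _].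
have e2 : 0 < complex.Re e by move: e0; rewrite ltcE /= => /andP[].
near=> y; rewrite -rmorphB normc_def /= expr0n addr0 sqrtr_sqr {1}e1 ltcR.
near: y. move: (complex.Re e) e2 => d d0.
exact: (@cvgr_dist_lt _ _ _ _ _ id).
Unshelve. all: by end_near. Qed.

(** * Vertices and interior points of a polyhedron *)

Lemma near0_ge0 (R : realType) (a c : R) : 0 < a ->
  \forall e \near 0^'+, 0 <= a + e * c.
Proof.
move=> a0; have c0 : 0 < `|c| + 1 by rewrite ltr_wpDl.
near=> e.
have e0 : 0 < e by [].
have ec : e * (`|c| + 1) < a by rewrite -ltr_pdivlMr//; near: e; apply: nbhs_right_lt; exact: divr_gt0.
have := ler_norm (- c); rewrite normrN => h.
have := ler_wpM2l (ltW e0) h; nra.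
Unshelve. all: by end_near. Qed.

Section Halfspaces.
Context {R : realType} {n m : nat} (L : 'M[R]_(n, m)) (b : 'rV[R]_m).

(** The value at [x] of the affine functional that defines the constraint [i]; below,
    [dslack] is its linear part. *)
Definition slack (x : 'rV[R]_n) (i : 'I_m) : R := (x *m L + b) 0 i.

Definition dslack (u : 'rV[R]_n) (i : 'I_m) : R := (u *m L) 0 i.

Definition halfspaces : set 'rV[R]_n := [set x | forall i, 0 <= slack x i].

Definition active (x : 'rV[R]_n) : {set 'I_m} := [set i | slack x i == 0].

Lemma slackD x u i : slack (x + u) i = slack x i + dslack u i.
Proof. by rewrite /slack /dslack mulmxDl !mxE addrAC. Qed.

Lemma dslackD u w i : dslack (u + w) i = dslack u i + dslack w i.
Proof. by rewrite /dslack mulmxDl mxE. Qed.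

Lemma dslackN u i : dslack (- u) i = - dslack u i.
Proof. by rewrite /dslack mulNmx mxE. Qed.

Lemma dslackZ a u i : dslack (a *: u) i = a * dslack u i.
Proof. by rewrite /dslack -scalemxAl mxE. Qed.

Lemma dslackB x y i : dslack (x - y) i = slack x i - slack y i.
Proof.
by have := slackD y (x - y) i; rewrite (addrC y) subrK => ->; rewrite [RHS]addrC addKr.
Qed.

(** The ray [x + t *: u], [0 <= t], stays in the polyhedron. *)
Lemma unbounded_ray x u : halfspaces x -> u != 0 ->
  (forall i, 0 <= dslack u i) -> ~ bounded_set halfspaces.
Proof.
move=> Px u0 du [M [_ /(_ (M + 1))]]; rewrite ltrDl ltr01 => /(_ isT) bd.
have nu : 0 < `|u| by rewrite normr_gt0.
pose t := (M + 2 + `|x|) / `|u|.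
have Mx : `|x| <= M + 1 by exact: bd.
have t0 : 0 <= t.
  by apply: divr_ge0 => //; have := normr_ge0 x; lra.
have : `|x + t *: u| <= M + 1.
  by apply: bd => i; rewrite slackD dslackZ addr_ge0// mulr_ge0.
have : `|t *: u| <= `|x + t *: u| + `|x|.
  by rewrite -{1}(addrK x (t *: u)) (addrC (t *: u)); exact: ler_normB.
rewrite normrZ (ger0_norm t0) /t divfK ?gt_eqF//; lra.
Qed.

(** A point with a maximal set of active constraints is a vertex: otherwise one
    can move along a direction killed by all the active constraints until a new
    constraint becomes active. *)
Lemma active_vertex x : bounded_set halfspaces -> halfspaces x ->
  exists v, [/\ halfspaces v, active x \subset active v &
    forall u, (forall i, i \in active v -> dslack u i = 0) -> u = 0].
Proof.
move=> bd; have [k] := ubnP (m - #|active x|).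
elim: k x => // k IH x; rewrite ltnS => lek Px.
have [h|] := pselect (forall u, (forall i, i \in active x -> dslack u i = 0) -> u = 0).
  by exists x; split.
move=> /existsNP[u /not_implyP[u_act /eqP u0]].
have [i0 i0neg] : exists i, dslack u i < 0.
  apply: contrapT => h; apply: (unbounded_ray Px u0) => // i.
  by rewrite leNgt; apply/negP => ?; apply: h; exists i.
(* r i is the time at which the ray from x along u meets the constraint i *)
pose r i := slack x i / - dslack u i.
have [i ineg imin] := arg_minP r (i0neg : (fun i => dslack u i < 0) i0).
pose y := x + r i *: u.
have ri0 : 0 <= r i by rewrite divr_ge0// oppr_ge0 ltW.
have slacky j : slack y j = slack x j + r i * dslack u j by rewrite slackD dslackZ.
have Py : halfspaces y.
  move=> j; rewrite slacky; case: (leP 0 (dslack u j)) => [uj|uj].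
    by rewrite addr_ge0// mulr_ge0.
  have := imin j uj; rewrite {2}/r ler_pdivlMr ?oppr_gt0//; lra.
have xy : active x \subset active y.
  apply/fintype.subsetP => j jx; rewrite inE slacky u_act// mulr0 addr0.
  by move: jx; rewrite inE.
have iy : i \in active y.
  by rewrite inE slacky /r invrN mulrN mulNr divfK ?(lt_eqF ineg)// subrr eqxx.
have ix : i \notin active x.
  by apply: contraTN ineg => /u_act ->; rewrite ltxx.
have ltxy : (#|active x| < #|active y|)%N.
  by apply: proper_card; rewrite properE xy; apply/fintype.subsetPn; exists i.
have [|v [Pv yv hv]] := IH y _ Py.
  rewrite (leq_trans _ lek)// ltn_sub2l// (leq_trans ltxy)//.
  by rewrite -[leqRHS]card_ord max_card.
by exists v; split=> //; exact: fintype.subset_trans xy yv.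
Qed.

(** The sum of the slacks of the active constraints is a supporting functional that
    vanishes at [v] only. *)
Lemma vertex_of_active v : halfspaces v ->
  (forall u, (forall i, i \in active v -> dslack u i = 0) -> u = 0) ->
  vertex halfspaces v.
Proof.
move=> Pv hv; pose d : 'cV[R]_m := \col_i (i \in active v)%:R.
exists (L *m d), ((b *m d) 0 0).
have E x : (x *m (L *m d)) 0 0 + (b *m d) 0 0 = \sum_(i in active v) slack x i.
  transitivity (((x *m L + b) *m d) 0 0); first by rewrite mulmxDl mulmxA [RHS]mxE.
  rewrite mxE [RHS]big_mkcond; apply: eq_bigr => i _.
  by rewrite -/(slack x i) [d _ _]mxE; case: ifP; rewrite ?mulr1 ?mulr0.
split=> [x Px|]; first by rewrite E; apply: sumr_ge0 => i _; exact: Px.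
apply/seteqP; split=> x /=; rewrite E.
  by move=> ->; split=> //; apply: big1 => i; rewrite inE => /eqP.
move=> [Px /eqP]; rewrite psumr_eq0 => [|i _]; last exact: Px.
move=> /allP hx; apply/eqP; rewrite -subr_eq0; apply/eqP/hv => i iv.
have /eqP vi : slack v i == 0 by rewrite inE in iv.
have /implyP/(_ iv)/eqP xi := hx i (mem_index_enum i).
by rewrite dslackB xi vi subr0.
Qed.

(** In homogeneous coordinates the [n.+1] points form an invertible matrix, which
    kills the column of coefficients of the constraint [i]. *)
Lemma simplex_in_hyperplane (p : 'M[R]_(n.+1, n)) i :
  row_free (row_mx (const_mx 1 : 'cV[R]_n.+1) p) ->
  (forall k, slack (row k p) i = 0) -> forall u, dslack u i = 0.
Proof.
rewrite row_free_unit => fp pi u.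
have : row_mx (const_mx 1 : 'cV[R]_n.+1) p *m col_mx (b 0 i)%:M (col i L) = 0.
  rewrite mul_row_col; apply/matrixP => k j; rewrite [RHS]mxE -[RHS](pi k).
  rewrite /slack -row_mul !mxE !big_ord_recl big_ord0 addr0 !mxE mul1r addrC.
  by rewrite ord1 eqxx mulr1n; congr (_ + _); apply: eq_bigr => l _; rewrite !mxE.
move=> /(congr1 (mulmx (invmx (row_mx (const_mx 1 : 'cV[R]_n.+1) p)))).
rewrite mulmx0 mulKmx// => /(congr1 (@dsubmx _ 1 n 1)); rewrite col_mxKd linear0 => Li.
rewrite /dslack mxE big1// => j _.
have /matrixP/(_ j 0) := Li; rewrite !mxE => ->; by rewrite mulr0.
Qed.

(** The barycentre of a full-dimensional simplex: a nonconstant constraint is not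
    active at all the vertices of the simplex. *)
Lemma interior_point : contains_simplex n halfspaces ->
  exists q, halfspaces q /\ forall i u, dslack u i != 0 -> 0 < slack q i.
Proof.
move=> [p Pp fp]; pose w : R := n.+1%:R^-1.
have w0 : 0 < w by rewrite invr_gt0 ltr0n.
pose q := (const_mx w : 'rV[R]_n.+1) *m p.
have E i : slack q i = \sum_k w * slack (row k p) i.
  rewrite /slack mxE /q -mulmxA mxE.
  rewrite (_ : b 0 i = \sum_(k < n.+1) w * b 0 i); last first.
    by rewrite sumr_const card_ord -mulr_natl mulrA divff ?mul1r// pnatr_eq0.
  rewrite -big_split; apply: eq_bigr => k _.
  by rewrite -row_mul !mxE mulrDr.
have Pq : halfspaces q.
  by move=> i; rewrite E sumr_ge0// => k _; rewrite mulr_ge0 ?(ltW w0)//; exact: Pp.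
exists q; split=> // i u ui; rewrite lt_neqAle Pq andbT eq_sym.
apply: contraNneq ui => q0; apply/eqP/(simplex_in_hyperplane fp) => k.
move/eqP: q0; rewrite E psumr_eq0 => [/allP/(_ k (mem_index_enum k))|j _].
  by rewrite mulf_eq0 gt_eqF//= => /eqP.
by rewrite mulr_ge0 ?(ltW w0)//; exact: Pp.
Qed.

End Halfspaces.

(** * Facets through a vertex *)

Section SimpleVertices.
Context {R : realType} {n' m : nat}.
Local Notation n := n'.+1.
Context (L : 'M[R]_(n, m)) (b : 'rV[R]_m).
Local Notation slack := (slack L b).
Local Notation dslack := (dslack L).
Local Notation P := (halfspaces L b).
Local Notation active := (active L b).

Lemma small_move v w : P v -> (forall i, i \in active v -> 0 <= dslack w i) ->
  \forall e \near 0^'+, P (v + e *: w).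
Proof.
move=> Pv hw; apply: filter_forall => i.
have [iv|iv] := boolP (i \in active v).
  near=> e; rewrite slackD dslackZ addr_ge0 ?mulr_ge0 ?hw//.
have vi : 0 < slack v i by rewrite inE in iv; rewrite lt_neqAle eq_sym iv Pv.
near=> e; rewrite slackD dslackZ; near: e; exact: near0_ge0.
Unshelve. all: by end_near. Qed.

Lemma hyperplane_basis i u : dslack u i != 0 ->
  exists2 K : 'M[R]_(n', n), row_free K & forall k, dslack (row k K) i = 0.
Proof.
move=> ui; pose c := col i L.
have rc : \rank c = 1.
  apply/eqP; rewrite eqn_leq rank_leq_col lt0n mxrank_eq0.
  apply: contraNneq ui => c0; rewrite /dslack mxE big1// => j _.
  by have /matrixP/(_ j 0) := c0; rewrite !mxE => ->; rewrite mulr0.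
have rk : \rank (kermx c) = n' by rewrite mxrank_ker rc subn1.
have : row_free (row_base (kermx c)) /\ row_base (kermx c) *m c = 0.
  rewrite row_base_free; split=> //; apply/sub_kermxP; by rewrite eq_row_base.
move: (row_base (kermx c)); rewrite rk => K [fK Kc].
exists K => // k; transitivity ((K *m c) k 0); last by rewrite Kc mxE.
by rewrite /dslack -row_mul !mxE; apply: eq_bigr => j _; rewrite !mxE.
Qed.

(** Moving from [v] along [u] one stays in the hyperplane of the constraint [i],
    and the other constraints in [I], which determine the polyhedron near [v],
    become strict.  So there is room around that point for a simplex of dimension
    [n'] in the hyperplane; [w] excludes that the constraint is constant. *)
Lemma irredundant_facet v (I : {set 'I_m}) i u w : P v -> i \in active v ->
  (forall u, (forall j, j \in I -> 0 <= dslack u j) ->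
     forall j, j \in active v -> 0 <= dslack u j) ->
  dslack u i = 0 -> (forall j, j \in I -> j != i -> 0 < dslack u j) ->
  dslack w i != 0 ->
  facet P [set x | P x /\ slack x i = 0].
Proof.
move=> Pv iv cone ui uj wi; split.
  exists (col i L), (b 0 i).
  have E x : (x *m col i L) 0 0 + b 0 i = slack x i.
    by rewrite /slack !mxE; congr (_ + _); apply: eq_bigr => j _; rewrite mxE.
  by split=> [x Px|]; [rewrite E; exact: Px|apply/seteqP; split=> x /=; rewrite E].
split; last first.
  move=> [p pF fp]; move: wi; rewrite (simplex_in_hyperplane (b := b) fp) ?eqxx// => k.
  by have [] := pF k.
have [K fK Ki] := hyperplane_basis wi.
pose K0 : 'M[R]_(1 + n', n) := col_mx 0 K.
have K0i k : dslack (row k K0) i = 0.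
  rewrite /K0; case: (split_ordP k) => l ->; first by rewrite rowKu row0 /dslack mul0mx mxE.
  by rewrite rowKd.
have [d [d0 hd]] : exists d : R, 0 < d /\ forall k j, j \in I -> 0 <= dslack (u + d *: row k K0) j.
  suff /filter_ex[d [d0 hd]] : \forall d \near (0 : R)^'+, 0 < d /\
      forall k j, j \in I -> 0 <= dslack (u + d *: row k K0) j by exists d.
  near=> d; split=> //; near: d.
  apply: filter_forall => k; apply: filter_forall => j.
  have [-> |ji] := eqVneq j i.
    by near=> d => _; rewrite dslackD dslackZ ui K0i mulr0 addr0.
  have [jI|jI] := boolP (j \in I); last by near=> d.
  near=> d => _; rewrite dslackD dslackZ; near: d; apply: near0_ge0; exact: uj.
have [e [e0 he]] : exists e : R, 0 < e /\ forall k, P (v + e *: (u + d *: row k K0)).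
  suff /filter_ex[e [e0 he]] : \forall e \near (0 : R)^'+, 0 < e /\
      forall k, P (v + e *: (u + d *: row k K0)) by exists e.
  near=> e; split=> //; near: e.
  apply: filter_forall => k; apply: small_move => //; apply: cone => j; exact: hd.
pose p : 'M[R]_(1 + n', n) := const_mx 1 *m (v + e *: u) + (e * d) *: K0.
have rowp k : row k p = v + e *: (u + d *: row k K0).
  rewrite /p linearD linearZ /= row_mul row_const.
  rewrite (_ : const_mx 1 = 1%:M) ?mul1mx; last by apply/rowP => j; rewrite ord1 !mxE.
  by rewrite scalerDr scalerA addrA.
exists p => [k|].
  rewrite /= rowp; split; first exact: he.
  rewrite slackD dslackZ dslackD dslackZ K0i ui mulr0 addr0 mulr0 addr0.
  by move: iv; rewrite inE => /eqP.
apply: inj_row_free => c; rewrite mul_mx_row => E.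
have := congr1 (@rsubmx _ _ 1 n) E; have := congr1 (@lsubmx _ _ 1 n) E.
rewrite row_mxKl row_mxKr !linear0 => c1.
rewrite mulmxDr mulmxA c1 mul0mx add0r -scalemxAr => /eqP.
rewrite scaler_eq0 mulf_eq0 !gt_eqF//= => /eqP.
rewrite /K0 -{1}[c](@hsubmxK _ 1 1 n') (@mul_row_col _ 1 1 n' n) mulmx0 add0r => /eqP.
rewrite mulmx_free_eq0// => /eqP cr.
have cl : lsubmx (c : 'rV[R]_(1 + n')) = 0.
  apply/rowP => j; rewrite ord1 [RHS]mxE.
  have /matrixP/(_ 0 0) := c1; rewrite mxE [X in _ = X -> _]mxE => <-.
  rewrite big_ord_recl big1 ?addr0 => [|k _]; rewrite !mxE mulr1.
    by congr (c 0 _); exact/val_inj.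
  have /rowP/(_ k) := cr; rewrite [LHS]mxE [RHS]mxE => <-.
  by congr (c 0 _); exact/val_inj.
by rewrite -[c](@hsubmxK _ 1 1 n') cl cr row_mx0.
Unshelve. all: by end_near. Qed.

End SimpleVertices.

(** * Simplicial cones at the vertices of a simple polytope *)

Section Frames.
Context {R : realType} {n' m : nat}.
Local Notation n := n'.+1.
Context (L : 'M[R]_(n, m)) (b : 'rV[R]_m).
Local Notation slack := (slack L b).
Local Notation dslack := (dslack L).
Local Notation P := (halfspaces L b).
Local Notation active := (active L b).

(** At the vertex [v], the [n] independent constraints [I k] define the same local cone
    as all the active constraints, so that this cone is simplicial. *)
Definition frame (v : 'rV[R]_n) (I : 'I_n -> 'I_m) : Prop :=
  [/\ P v, forall k, I k \in active v, colsub I L \in unitmx &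
      forall u, (forall k, 0 <= dslack u (I k)) ->
        forall i, i \in active v -> 0 <= dslack u i].

Lemma dslack_colsub k (I : 'I_k -> 'I_m) u : u *m colsub I L = \row_j dslack u (I j).
Proof. by apply/rowP => j; rewrite mulmx_colsub mxE [RHS]mxE. Qed.

Lemma slack_colsub (I : 'I_n -> 'I_m) x :
  x *m colsub I L + colsub I b = \row_k slack x (I k).
Proof. by apply/rowP => j; rewrite mulmx_colsub mxE [RHS]mxE /slack !mxE. Qed.

Lemma active_slack v i : i \in active v -> slack v i = 0.
Proof. by rewrite inE => /eqP. Qed.

(** Among the sets of constraints active at a vertex [v] that define the local cone,
    take a minimal one, [J].  Each of its members is irredundant and cuts out a
    facet through [v], and these facets are distinct, so that [J] has at most [n]
    elements by simplicity.  It has at least [n] because the cone is pointed. *)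
Lemma simple_frame x : simple_polytope P -> P x ->
  exists v I, frame v I /\ active x \subset active v.
Proof.
move=> [[_ bd [simplexP _]] simP] Px.
have [v [Pv xv hv]] := active_vertex bd Px.
have [q [Pq qpos]] := interior_point simplexP.
have cardF := simP v (vertex_of_active Pv hv).
pose cone (J : {set 'I_m}) := forall u, (forall i, i \in J -> 0 <= dslack u i) ->
  forall i, i \in active v -> 0 <= dslack u i.
have [|J /minsetP[/asboolP coneJ minJ] Jv] :=
    @minset_exists _ (fun J => `[< cone J >]) (active v).
  by apply/asboolP => u hu i /hu.
(* minimality: without i, the other members of J admit a direction that violates i *)
have ray i : i \in J -> exists u, dslack u i < 0 /\
    forall j, j \in J -> j != i -> 0 <= dslack u j.
  move=> iJ; apply: contrapT => noray.
  have iNJ : i \notin J :\ i by rewrite !inE eqxx.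
  suff /asboolP/minJ/(_ (subsetDl _ _)) E : cone (J :\ i) by move: iNJ; rewrite E iJ.
  move=> u hu; apply: coneJ => j jJ; have [->|ji] := eqVneq j i; last first.
    by apply: hu; rewrite !inE ji.
  rewrite leNgt; apply/negP => ui; apply: noray; exists u; split=> // l lJ li.
  by apply: hu; rewrite !inE li.
have vJ i : i \in J -> slack v i = 0 by move=> iJ; apply/active_slack/(fintype.subsetP Jv).
have inside i : i \in J -> 0 < dslack (q - v) i.
  move=> iJ; have [u [ui _]] := ray i iJ.
  by rewrite (dslackB _ b) vJ// subr0 (qpos i u)// lt_eqF.
(* correct that direction by an interior one until i is active *)
have edge i : i \in J -> exists u, dslack u i = 0 /\
    forall j, j \in J -> j != i -> 0 < dslack u j.
  move=> iJ; have [u [ui uj]] := ray i iJ; have qi := inside i iJ.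
  exists (u + (- dslack u i / dslack (q - v) i) *: (q - v)); split=> [|j jJ ji].
    by rewrite dslackD dslackZ divfK ?gt_eqF// subrr.
  rewrite dslackD dslackZ ltr_wpDl ?uj//.
  by rewrite mulr_gt0 ?inside// divr_gt0// oppr_gt0.
pose F i := [set x : 'rV[R]_n | P x /\ slack x i = 0].
have facetF i : i \in J -> facet P (F i) /\ F i v.
  move=> iJ; have [u [ui uj]] := edge i iJ; have [w [wi _]] := ray i iJ.
  split; last by split=> //; exact: vJ.
  apply: (irredundant_facet Pv _ coneJ ui uj (w := w)); last by rewrite lt_eqF.
  exact: (fintype.subsetP Jv).
have injF i j : i \in J -> j \in J -> F i = F j -> i = j.
  move=> iJ jJ Fij; apply/eqP; apply: contrapT => /negP ij.
  have [u [ui uj]] := edge i iJ.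
  have : \forall e \near (0 : R)^'+, 0 < e /\ P (v + e *: u).
    near=> e; split=> //; near: e; apply: small_move => // l; apply: coneJ => l' l'J.
    by have [->|] := eqVneq l' i; [rewrite ui|move=> /uj -/(_ l'J)/ltW].
  move=> /filter_ex[e [e0 Pe]].
  have : F i (v + e *: u) by split=> //; rewrite slackD dslackZ ui mulr0 addr0 vJ.
  rewrite Fij => -[_]; rewrite slackD dslackZ vJ// add0r => /eqP.
  by rewrite mulf_eq0 !gt_eqF// uj// eq_sym.
have leJ : (#|J| <= n)%N.
  have /card_set_bijP[f [fn finj _]] := cardF.
  rewrite -[n]card_ord; apply: (@leq_card_in _ _ (fun i => inord (f (F i)) : 'I_n)).
  move=> i j iJ jJ /(congr1 val) /=; rewrite !inordK; try by apply: fn; exact: facetF.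
  move=> /finj fij; apply: injF => //; apply: fij; rewrite inE; exact: facetF.
have freeJ k (f : 'I_k -> 'I_m) : (forall i, i \in J -> exists l, f l = i) ->
    row_free (colsub f L).
  move=> fJ; apply: inj_row_free => u; rewrite dslack_colsub => uf; apply: hv.
  have u0 i : i \in J -> dslack u i = 0.
    by move=> /fJ[l <-]; have /rowP/(_ l) := uf; rewrite !mxE.
  move=> i iv; apply/eqP; rewrite eq_le -oppr_ge0 -dslackN.
  by rewrite !coneJ// => j jJ; rewrite ?dslackN u0// oppr0.
have geJ : (n <= #|J|)%N.
  have /eqP <- : row_free (colsub (fun l : 'I_#|J| => enum_val l) L).
    apply: freeJ => i iJ; exists (enum_rank_in iJ i); exact: enum_rankK_in.
  exact: rank_leq_col.
have cJ : n = #|J| by apply/eqP; rewrite eqn_leq leJ geJ.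
pose I (k : 'I_n) : 'I_m := enum_val (cast_ord cJ k).
have IJ k : I k \in J by exact: enum_valP.
have JI i : i \in J -> exists k, I k = i.
  move=> iJ; exists (cast_ord (esym cJ) (enum_rank_in iJ i)).
  by rewrite /I cast_ordKV enum_rankK_in.
exists v, I; split=> //; split=> // [k||u uI].
- exact: (fintype.subsetP Jv).
- by rewrite -row_free_unit; exact: freeJ.
- by apply: coneJ => i /JI[k <-].
Unshelve. all: by end_near. Qed.

Lemma frame_inj v I x y : frame v I ->
  (forall k, slack x (I k) = slack y (I k)) -> x = y.
Proof.
move=> [_ _ uI _] xy; apply/eqP; rewrite -subr_eq0 -(mulmx_free_eq0 _ (B := colsub I L)).
  by rewrite dslack_colsub; apply/eqP/rowP => k; rewrite !mxE (dslackB _ b) xy subrr.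
by rewrite row_free_unit.
Qed.

End Frames.

(** * Charts of a simple polytope and the constancy of faces along paths *)

Section Charts.
Context {R : realType} {n' m : nat}.
Local Notation n := n'.+1.
Context (L : 'M[R]_(n, m)) (b : 'rV[R]_m).
Local Notation slack := (slack L b).
Local Notation dslack := (dslack L).
Local Notation P := (halfspaces L b).
Local Notation active := (active L b).
Local Notation frame := (frame L b).

Lemma continuous_slack i : continuous (fun x => slack x i).
Proof.
move=> x.
apply: (@continuous_comp _ _ _ (fun x : 'rV[R]_n => x *m L + b) (fun M : 'rV[R]_m => M 0 i)).
  apply: continuousD; [exact: continuous_mulmxr|exact: cst_continuous].
exact: coord_continuous.
Qed.

Lemma near_active x : P x -> \forall y \near x, active y \subset active x.
Proof.
move=> Px.
have h : \forall y \near x, forall i, i \notin active x -> 0 < slack y i.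
  apply: (@filter_forall _ _ _ (nbhs x)) => i.
  have [ix|ix] := boolP (i \in active x); first by near=> y.
  have xi : 0 < slack x i by rewrite inE in ix; rewrite lt_neqAle eq_sym ix Px.
  near=> y => _; near: y; exact: (cvgr_gt _ (@continuous_slack i x)).
near=> y; apply/fintype.subsetP => i iy; apply: contraTT isT => ix.
have : 0 < slack y i by move: i ix {iy}; near: y.
by rewrite (active_slack iy) ltxx.
Unshelve. all: by end_near. Qed.

(** The slacks of the [n] constraints of a frame as local coordinates. *)
Definition frame_chart (v : 'rV[R]_n) (I : 'I_n -> 'I_m) : set P * (P -> 'rV[R]_n) :=
  ([set y : P | active (set_val y) \subset active v],
   fun y => set_val y *m colsub I L + colsub I b).

Lemma frame_chart_codim v I (y : P) :
  codim ((frame_chart v I).2 y) = #|[pred k | slack (set_val y) (I k) == 0]|.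
Proof.
by rewrite /codim /frame_chart /= slack_colsub; apply: eq_card => k; rewrite !inE mxE.
Qed.

(** Where only constraints active at [v] can be active, a point belongs to the polytope
    as soon as its [n] coordinates are nonnegative. *)
Lemma frame_chart_atlas v I : frame v I -> polytope_atlas P (frame_chart v I).
Proof.
move=> fI; have [Pv Iv uI coneI] := fI.
pose O := [set x : 'rV[R]_n | forall i, i \notin active v -> 0 < slack x i].
have oO : open O.
  rewrite openE => x Ox; apply: (@filter_forall _ _ _ (nbhs x)) => i.
  have [iv|iv] := boolP (i \in active v); first by near=> y.
  near=> y => _; near: y; exact: (cvgr_gt _ (@continuous_slack i x) _ (Ox i iv)).
have domE (y : P) : (frame_chart v I).1 y <-> O (set_val y).
  split=> [/fintype.subsetP yv i iv|Oy].
    by rewrite lt_neqAle eq_sym (set_valP y) andbT; apply: contra iv => yi; apply: yv; rewrite inE.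
  apply/fintype.subsetP => i iy; apply: contraTT isT => /Oy.
  by rewrite (active_slack iy) ltxx.
split; last by exists (colsub I L), (colsub I b).
split.
- rewrite (_ : (frame_chart v I).1 = set_val @^-1` O); first by exists O.
  by apply/seteqP; split=> y /domE.
- move=> y z _ _ /addIr /eqP; rewrite -subr_eq0 -mulmxBl mulmx_free_eq0 ?row_free_unit//.
  by rewrite subr_eq0 => /eqP; exact: val_inj.
- move=> y _.
  apply: (@continuousD _ _ _ (fun y : P => set_val y *m colsub I L) (fun=> colsub I b));
    last exact: cst_continuous.
  apply: (@continuous_comp _ _ _ set_val (fun x : 'rV[R]_n => x *m colsub I L)).
    exact: initial_continuous.
  exact: continuous_mulmxr.
- move=> _ [V oV <-] VO.
  pose g (w : 'rV[R]_n) := (w - colsub I b) *m invmx (colsub I L).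
  have gK w : g w *m colsub I L + colsub I b = w by rewrite /g mulmxKV// subrK.
  have Kg x : g (x *m colsub I L + colsub I b) = x by rewrite /g addrK mulmxK.
  exists (g @^-1` (V `&` O)).
    apply: open_comp; last exact: openI.
    move=> w _; apply: (@continuous_comp _ _ _ (fun w : 'rV[R]_n => w - colsub I b)
      (fun w : 'rV[R]_n => w *m invmx (colsub I L))); last exact: continuous_mulmxr.
    by apply: continuousB; [by move=> ?|exact: cst_continuous].
  apply/seteqP; split=> [_ [y Vy <-]|w [[Vw Ow] w0]] /=.
    rewrite Kg; split; first by split=> //; apply/domE/VO.
    by move=> k; rewrite slack_colsub mxE; exact: (set_valP y).
  have gw k : slack (g w) (I k) = w 0 k.
    by have /rowP/(_ k) := slack_colsub L b I (g w); rewrite gK mxE.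
  have Pg : P (g w).
    move=> i; have [iv|/Ow/ltW //] := boolP (i \in active v).
    have := coneI (g w - v) _ i iv; rewrite (dslackB _ b) (active_slack iv) subr0; apply.
    by move=> k; rewrite (dslackB _ b) gw (active_slack (Iv k)) subr0.
  by exists (exist _ (g w) (mem_set Pg)); rewrite //= set_valE /= gK.
Unshelve. all: by end_near. Qed.

(** [x] lies in the relative interior of a face of codimension [d], as seen in all
    the frames around it. *)
Definition face_codim (d : nat) (x : 'rV[R]_n) : Prop :=
  forall v I, frame v I -> active x \subset active v ->
    #|[pred k | slack x (I k) == 0]| = d.

(** Near [x = h t] a point [y] of the same codimension has the same vanishing
    coordinates, so that the reflection [2x - y] is still in the polytope.  A
    constraint that vanishes at [x] and is nonnegative at [y] and at [2x - y]
    vanishes at [y]. *)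
Lemma active_locally_constant d (h : R -> 'rV[R]_n) i t :
  simple_polytope P -> continuous h -> (forall s, P (h s)) -> 0 < t ->
  (forall s, 0 < s -> face_codim d (h s)) ->
  slack (h t) i = 0 -> \forall s \near t, slack (h s) i = 0.
Proof.
move=> sP ch Ph t0 hd hi.
have [v [I [fI tv]]] := simple_frame sP (Ph t); have [Pv Iv uI coneI] := fI.
have cs j : {for t, continuous (fun s => slack (h s) j)}.
  by apply: (@continuous_comp _ _ _ h (fun x => slack x j)); [exact: ch|exact: continuous_slack].
near=> s.
have s0 : 0 < s by near: s; exact: lt_nbhsr.
have st : active (h s) \subset active (h t).
  by near: s; exact: (ch t _ (near_active (Ph t))).
have zE : [pred k | slack (h s) (I k) == 0] =i [pred k | slack (h t) (I k) == 0].
  apply/subset_cardP.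
    by rewrite (hd _ t0 v I)// (hd _ s0 v I)//; exact: fintype.subset_trans tv.
  apply/fintype.subsetP => k; rewrite !inE => sk.
  by have := fintype.subsetP st (I k); rewrite !inE; exact.
have le2 k : slack (h s) (I k) <= 2 * slack (h t) (I k).
  have [tk|tk] := eqVneq (slack (h t) (I k)) 0.
    by have := zE k; rewrite !inE tk eqxx => /eqP ->; rewrite mulr0.
  have tk0 : 0 < slack (h t) (I k) by rewrite lt_neqAle eq_sym tk Ph.
  move: k tk tk0; near: s; apply: filter_forall => k.
  have [tk|tk] := boolP (0 < slack (h t) (I k)); last by near=> s.
  near=> s => _ _; near: s; apply: (cvgr_le _ (cs (I k))); lra.
have iv : i \in active v by apply: (fintype.subsetP tv); rewrite inE hi.
have := coneI (h t + (h t - h s) - v) _ i iv.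
rewrite (dslackB _ b) slackD (dslackB _ b) hi (active_slack iv) => H.
apply/eqP; rewrite eq_le Ph andbT -oppr_ge0; move: H; rewrite add0r subr0 sub0r; apply => k.
rewrite (dslackB _ b) slackD (dslackB _ b) (active_slack (Iv k)).
by have := le2 k; lra.
Unshelve. all: by end_near. Qed.

(** The zero set of a constraint along [h] is closed, and open in the positive
    half-line by [active_locally_constant]; it contains [1], so it contains the
    half-line and its closure. *)
Lemma active_path d (h : R -> 'rV[R]_n) :
  simple_polytope P -> continuous h -> (forall s, P (h s)) ->
  (forall s, 0 < s -> face_codim d (h s)) -> active (h 1) \subset active (h 0).
Proof.
move=> sP ch Ph hd; apply/fintype.subsetP => i; rewrite !inE => /eqP i1.
have cs : continuous (fun s => slack (h s) i).
  by move=> s; apply: (@continuous_comp _ _ _ h (fun x => slack x i)); [exact: ch|exact: continuous_slack].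
pose S := [set s | slack (h s) i = 0].
have cS : closed S by apply: (closed_comp (D := [set 0])) => // s _; exact: cs.
pose H := [set s : R | 0 < s].
have conn : connected (H : set R).
  apply/connected_intervalP => x y x0 y0 z /andP[xz _].
  exact: lt_le_trans x0 xz.
have pos : H `&` S = H.
  apply: conn; first by exists 1; split=> //=; exact: ltr01.
    exists (interior S); first exact: open_interior.
    apply/seteqP; split=> s [s0 Ss]; split=> //; last exact: interior_subset.
    exact: (active_locally_constant sP ch Ph s0 hd Ss).
  by exists S.
have : closure S 0.
  move=> B /nbhs_ballP[e e0 Be]; exists (e / 2); split.
    have : H (e / 2) by exact: divr_gt0.
    by rewrite -pos => -[].
  by apply: Be; rewrite /ball /= sub0r normrN gtr0_norm ?divr_gt0// ltr_pdivrMr// ltr_pMr// ltr1n.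
by move=> /cS ->.
Qed.

Lemma vertex_slack v I x : frame v I -> active x \subset active v ->
  face_codim n x -> forall k, slack x (I k) = 0.
Proof.
move=> fI xv dx k.
have e : #|[pred k | slack x (I k) == 0]| = #|{: 'I_n}| by rewrite (dx v I)// card_ord.
by have /(_ k) := subset_cardP e (subset_predT _); rewrite !inE => /eqP.
Qed.

(** A constraint active at an inner point of a segment of the polytope is active along
    the whole segment. *)
Lemma vertex_extreme p q x a : simple_polytope P -> P p -> P q -> P x ->
  face_codim n x -> 0 < a -> a < 1 -> x = p + a *: (q - p) -> p = x.
Proof.
move=> sP Pp Pq Px dx a0 a1 xE; have [v [I [fI xv]]] := simple_frame sP Px.
have xI := vertex_slack fI xv dx.
apply: (frame_inj fI) => k; rewrite xI; apply/eqP; rewrite eq_le Pp andbT.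
have := xI k; rewrite {1}xE slackD dslackZ (dslackB _ b).
have := Pp (I k); have := Pq (I k); nra.
Qed.

(** Two edges at a vertex [p] leave it along different generators of its
    simplicial cone, and a 2-face containing both edges lies in the cone that
    they span. *)
Lemma vertex_cone p q1 q2 q e1 e2 c : simple_polytope P ->
  [/\ P p, P q1, P q2 & P q] ->
  [/\ face_codim n p, face_codim n q1 & face_codim n q2] ->
  [/\ face_codim n.-1 e1, face_codim n.-1 e2 & face_codim n.-2 c] ->
  (2 <= n)%N ->
  [/\ active e1 \subset active p, active e2 \subset active p & active c \subset active p] ->
  active e1 \subset active q1 -> active e2 \subset active q2 ->
  [/\ active c \subset active q1, active c \subset active q2 & active c \subset active q] ->
  [/\ q1 <> p, q2 <> p & q1 <> q2] ->
  exists r1 r2, [/\ 0 <= r1, 0 <= r2 & q = p + r1 *: (q1 - p) + r2 *: (q2 - p)].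
Proof.
move=> sP [Pp Pq1 Pq2 Pq] [dp d1 d2] [de1 de2 dc] n2 [e1p e2p cp] e1q e2q [cq1 cq2 cq] [q1p q2p q12].
have [v [I [fI pv]]] := simple_frame sP Pp.
have pI := vertex_slack fI pv dp.
(* the coordinates at p that do not vanish at x *)
pose T x := ~: [set k | slack x (I k) == 0].
have cardT d x : face_codim d x -> active x \subset active p -> #|T x| = (n - d)%N.
  move=> dx xp; rewrite cardsCs finset.setCK card_ord; congr (_ - _)%N.
  by rewrite -(dx v I fI (fintype.subset_trans xp pv)); apply: eq_card => k; rewrite !inE.
have outT x y k : active x \subset active y -> slack y (I k) != 0 -> k \in T x.
  move=> /fintype.subsetP xy; rewrite !inE; apply: contra => xk.
  by have := xy (I k); rewrite !inE; apply.
have ray e y : face_codim n.-1 e -> active e \subset active p -> active e \subset active y ->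
    P y -> y <> p -> exists k, 0 < slack y (I k) /\ forall l, l != k -> slack y (I l) = 0.
  move=> de ep ey Py yp.
  have /eqP/cards1P[k Tk] : #|T e| = 1%N by rewrite (cardT _ _ de ep) subSnn.
  have yl l : l != k -> slack y (I l) = 0.
    move=> lk; apply: contraNeq lk => /(outT _ _ _ ey); by rewrite Tk inE.
  exists k; split=> //; rewrite lt_neqAle Py andbT eq_sym; apply/eqP => yk.
  apply: yp; apply: (frame_inj fI) => l; rewrite pI.
  by have [->|/yl] := eqVneq l k.
have [k1 [k1pos k1z]] := ray _ _ de1 e1p e1q Pq1 q1p.
have [k2 [k2pos k2z]] := ray _ _ de2 e2p e2q Pq2 q2p.
(* on a common ray the nearer of q1 and q2 would lie between p and the other *)
have k12 : k1 != k2.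
  apply/eqP => k12; move: k2pos k2z; rewrite -k12 => k2pos k2z.
  have prop x y a : (forall l, l != k1 -> slack x (I l) = 0) ->
      (forall l, l != k1 -> slack y (I l) = 0) ->
      slack x (I k1) = a * slack y (I k1) -> x = p + a *: (y - p).
    move=> xz yz xy; apply: (frame_inj fI) => l.
    rewrite slackD dslackZ (dslackB _ b) pI add0r subr0.
    by have [->|l1] := eqVneq l k1; rewrite ?xy// xz// yz// mulr0.
  have [lt12|lt21|eq12] := ltgtP (slack q1 (I k1)) (slack q2 (I k1)).
  - apply/q1p/esym/(vertex_extreme (a := slack q1 (I k1) / slack q2 (I k1)) sP Pp Pq2 Pq1 d1).
    + exact: divr_gt0.
    + by rewrite ltr_pdivrMr// mul1r.
    + by apply: prop => //; rewrite divfK ?gt_eqF.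
  - apply/q2p/esym/(vertex_extreme (a := slack q2 (I k1) / slack q1 (I k1)) sP Pp Pq1 Pq2 d2).
    + exact: divr_gt0.
    + by rewrite ltr_pdivrMr// mul1r.
    + by apply: prop => //; rewrite divfK ?gt_eqF.
  - apply: q12; apply: (frame_inj fI) => l.
    by have [->|l1] := eqVneq l k1; rewrite ?eq12// k1z// k2z.
have Tc : T c = [set k1; k2]%SET.
  apply/esym/eqP; rewrite eqEcard (cardT _ _ dc cp) cards2 k12.
  rewrite (_ : (n - n.-2)%N = 2) ?andbT; last by rewrite -[in LHS](subnK n2) addn2 /= -add2n addnK.
  by apply/fintype.subsetP => k; rewrite !inE => /orP[]/eqP ->;
    [have := outT _ _ k1 cq1|have := outT _ _ k2 cq2]; rewrite inE gt_eqF// inE; apply.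
have qz k : k != k1 -> k != k2 -> slack q (I k) = 0.
  move=> n1 n2'; apply: contraNeq n1 => /(outT _ _ _ cq).
  by rewrite Tc !inE (negPf n2') orbF.
exists (slack q (I k1) / slack q1 (I k1)), (slack q (I k2) / slack q2 (I k2)).
split; try by rewrite divr_ge0 ?Pq// ltW.
apply: (frame_inj fI) => k.
rewrite !slackD !dslackZ !(dslackB _ b) !pI add0r !subr0.
have [->|kk1] := eqVneq k k1; first by rewrite divfK ?gt_eqF// (k2z k1)// mulr0 addr0.
have [->|kk2] := eqVneq k k2; first by rewrite divfK ?gt_eqF// (k1z k2) 1?eq_sym// mulr0 add0r.
by rewrite qz// (k1z k)// (k2z k)// !mulr0 addr0.
Qed.

End Charts.

(** * Codimension in the orbit space *)

Section TwoTorsion.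
Context {R : realType} {n : nat}.
Local Notation C := R[i].

(** The elements of order at most two of the torus. *)
Definition signs (S : {set 'I_n}) : 'rV[C]_n := \row_j (-1) ^+ (j \in S).

Lemma torus_signs S : torus n (signs S).
Proof. by move=> j; rewrite mxE normrX normrN1 expr1n. Qed.

Lemma signs_sqr S : torus_mul (signs S) (signs S) = const_mx 1.
Proof. by apply/rowP => j; rewrite !mxE -expr2 sqrr_sign. Qed.

Lemma signs_fix S (z : 'rV[C]_n) :
  torus_mul (signs S) z = z <-> (S \subset [set j | z 0 j == 0]%SET).
Proof.
split=> [/rowP zS|/fintype.subsetP zS].
  apply/fintype.subsetP => j jS; rewrite inE; have := zS j; rewrite !mxE jS mulN1r.
  by move/eqP; rewrite -subr_eq0 -opprD oppr_eq0 -mulr2n -mulr_natr mulf_eq0 pnatr_eq0 orbF.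
apply/rowP => j; rewrite !mxE; have [/zS|_] := boolP (j \in S); last by rewrite mul1r.
by rewrite inE => /eqP ->; rewrite mulr0.
Qed.

Lemma signs_inj : injective signs.
Proof.
move=> S S' /rowP e; apply/setP => j; have := e j; rewrite !mxE.
have n1 : (1 : C) != -1 by rewrite -subr_eq0 opprK (pnatr_eq0 _ 2).
by case: (j \in S); case: (j \in S') => //= /eqP; rewrite ?(negPf n1)// eq_sym (negPf n1).
Qed.

(** The entries of the image are square roots of [1]. *)
Lemma automorphism_signs psi : torus_automorphism psi -> forall S : {set 'I_n},
  psi (signs S) = signs [set j | psi (signs S) 0 j == -1].
Proof.
move=> [[psiT _ _] psiM _] S.
have tor1 : torus n (const_mx 1 : 'rV[C]_n) by move=> j; rewrite mxE normr1.
have nz (t : 'rV[C]_n) j : torus n t -> t 0 j != 0.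
  by move=> Tt; rewrite -normr_eq0 Tt oner_neq0.
have psi1 j : psi (const_mx 1) 0 j = 1.
  have e : torus_mul (const_mx 1) (const_mx 1) = const_mx 1 :> 'rV[C]_n.
    by apply/rowP => k; rewrite !mxE mulr1.
  have := psiM _ _ (mem_set tor1) (mem_set tor1); rewrite e => /rowP/(_ j).
  by rewrite mxE -[LHS]mulr1 => /(mulfI (nz _ j (psiT _ tor1))).
have TS := torus_signs S.
apply/rowP => j; rewrite mxE inE.
have := psiM _ _ (mem_set TS) (mem_set TS); rewrite signs_sqr => /rowP/(_ j).
rewrite psi1 mxE -expr2 => /esym/eqP; rewrite sqrf_eq1.
have n1 : (1 == -1 :> C) = false by apply/negbTE; rewrite -subr_eq0 opprK (pnatr_eq0 _ 2).
by move=> /orP[]/eqP ->; rewrite ?n1 ?eqxx.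
Qed.

End TwoTorsion.

Section OrbitChart.
Context {R : realType} {n : nat} (lambda : 'I_n.+1 -> R).
Local Notation X := (isospectral_arrow lambda).
Local Notation act := (arrow_action lambda).

(** The vanishing entries of an arrow matrix in the row [0], off the diagonal. *)
Definition zero_legs (A : 'M[R[i]]_n.+1) : {set 'I_n} :=
  [set k | A 0 (lift 0 k) == 0].

Lemma hermitian_entry (A : 'M[R[i]]_n.+1) i j : A \is hermsymmx -> A i j = (A j i)^*.
Proof.
move/is_hermitianmxP; rewrite expr0 scale1r => /matrixP/(_ i j) ->.
by rewrite !mxE.
Qed.

Lemma arrow_act_signs A S : X A ->
  arrow_act (signs S) A = A <-> (S \subset zero_legs A).
Proof.
move=> [hA aA _]; have [t0 tS] := torus_sectionE (signs S : 'rV[R[i]]_n).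
have E i j := diag_conjE A i j (torus_section_torus (@torus_signs R n S)).
split=> [/matrixP e|/fintype.subsetP SA].
  apply/fintype.subsetP => k kS; rewrite inE; have := e 0 (lift 0 k).
  rewrite E t0 tS mxE kS mul1r expr1 invrN1 mulrN1 => /eqP.
  by rewrite -subr_eq0 -opprD oppr_eq0 -mulr2n -mulr_natr mulf_eq0 pnatr_eq0 orbF.
have leg k : k \in S -> A 0 (lift 0 k) = 0 by move=> /SA; rewrite inE => /eqP.
apply/matrixP => i j; rewrite E.
case: (unliftP 0 i) => [k ->|->]; case: (unliftP 0 j) => [l ->|->];
  rewrite ?t0 ?tS ?mul1r ?divr1 ?mxE //.
- have [->|kl] := eqVneq k l.
    by rewrite mulrAC divff ?mul1r// signr_eq0.
  by rewrite aA ?mulr0 ?mul0r// (inj_eq lift_inj).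
- have [/leg kS|_] := boolP (k \in S); last by rewrite mul1r.
  by rewrite (hermitian_entry _ _ hA) kS conjC0 mulr0.
- have [/leg ->|_] := boolP (l \in S); last by rewrite divr1.
  by rewrite mul0r.
Qed.

(** The 2-torsion of the stabiliser of a point has [2 ^ d] elements, where [d] is
    the number of vanishing coordinates, both for the standard action in the chart
    and for the action on the matrix.  The chart is equivariant up to an
    automorphism of the torus, so the two numbers agree. *)
Lemma orbit_chart_codim c (x : X) : orbit_atlas act c -> c.1 (orbit_proj act x) ->
  codim (c.2 (orbit_proj act x)) = #|zero_legs (set_val x)|.
Proof.
move=> [U [phi [[oU invU [V oV [g [phig _ _ _]]] [psi autpsi equiv]] c1 c2]]].
rewrite c1 => -[y Uy /eqmodP yx].
have Ux : U x by apply: invU Uy _.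
rewrite (c2 _ Ux).
have phi_inj (a b : X) : U a -> U b -> phi (set_val a) = phi (set_val b) ->
    set_val a = set_val b.
  have cK (M : 'M[R[i]]_n.+1) : complexify (realify M) = M.
    by apply/matrixP => i j; rewrite !mxE; case: (M i j).
  have gK (z : X) : U z -> g (realify (phi (set_val z))) = realify (set_val z).
    move=> Uz; have Rz : (realify @` (set_val @` U)) (realify (set_val z)).
      by exists (set_val z) => //; exists z.
    by have [_] := phig _ Rz; rewrite /= cK.
  by move=> Ua Ub ab; rewrite -[LHS]cK -[RHS]cK -!gK// ab.
pose Psi (S : {set 'I_n}) := [set j | psi (signs S) 0 j == -1]%SET.
have PsiE S : psi (signs S) = signs (Psi S) := automorphism_signs autpsi S.
have [[_ psi_inj _] _ _] := autpsi.
have Psi_inj : injective Psi.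
  move=> S S' e; apply: (@signs_inj R); apply: psi_inj; rewrite ?inE; try exact: torus_signs.
  by rewrite !PsiE e.
pose Z := [set j | phi (set_val x) 0 j == 0]%SET.
have key S : (Psi S \subset Z) = (S \subset zero_legs (set_val x)).
  have Xx : X (set_val x) by exact: set_valP.
  pose y' : X := exist _ (act (signs S) (set_val x))
    (mem_set (tact_stable act (@torus_signs R n S) Xx)).
  have Uy' : U y'.
    by apply: (invU x) => //; apply/asboolP; exists (signs S) => //; exact: torus_signs.
  have [fix1 fix2] := signs_fix (Psi S) (phi (set_val x)).
  have [act1 act2] := arrow_act_signs S Xx.
  apply/idP/idP => [/fix2|/act2 e].
    rewrite -PsiE -equiv//; last exact: torus_signs.
    move=> e; apply: act1; exact: (phi_inj y' x).
  by apply: fix1; rewrite -PsiE -equiv//; [rewrite [act _ _]e|exact: torus_signs].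
have : #|Psi @^-1: powerset Z| = #|powerset Z|.
  by apply: on_card_preimset; apply: onW_bij; exact: injF_bij.
rewrite (_ : Psi @^-1: powerset Z = powerset (zero_legs (set_val x))); last first.
  by apply/setP => S; rewrite !inE key.
rewrite !card_powerset => /eqP; rewrite eqn_exp2l// => /eqP ->.
apply: eq_card => j; rewrite !inE mxE -[in RHS]normr_eq0 normc_def.
by rewrite [in RHS]eq_complex /= eqxx andbT.
Qed.

End OrbitChart.

(** * Real arrow matrices and their spectrum *)

Section RealArrow.
Context {R : realType} {n : nat}.

(** The real symmetric arrow matrix with diagonal [a] and legs [b u], [u != 0]. *)
Definition real_arrow (a b : 'I_n.+1 -> R) : 'M[R]_n.+1 :=
  \matrix_(u, v) if u == v then a u else if v == 0 then b u
                 else if u == 0 then b v else 0.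

Definition arrow_mx (a b : 'I_n.+1 -> R) : 'M[R[i]]_n.+1 :=
  map_mx (real_complex R) (real_arrow a b).

Lemma eigenvalue_arrow (a b v : 'I_n.+1 -> R) z u0 : v u0 != 0 ->
  v 0 * a 0 + \sum_(u | u != 0) v u * b u = z * v 0 ->
  (forall u, u != 0 -> v 0 * b u + v u * a u = z * v u) ->
  eigenvalue (real_arrow a b) z.
Proof.
move=> vu0 e0 e; apply/eigenvalueP; exists (\row_u v u); last first.
  by apply: contraNneq vu0 => /rowP/(_ u0); rewrite !mxE => ->.
apply/rowP => u; rewrite !mxE; have [->|un0] := eqVneq u 0.
  rewrite -e0 (bigD1 0)//= !mxE eqxx; congr (_ + _); apply: eq_bigr => k k0.
  by rewrite !mxE (negPf k0).
rewrite -e// (bigD1 0)//= (bigD1 u)//= big1 => [|k /andP[k0 ku]].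
  by rewrite !mxE eqxx [0 == u]eq_sym (negPf un0) addr0.
by rewrite !mxE (negPf k0) (negPf ku) (negPf un0) mulr0.
Qed.

Lemma eigenvalue_no_leg (a b : 'I_n.+1 -> R) u : b u = 0 ->
  (u = 0 -> forall w, b w = 0) -> eigenvalue (real_arrow a b) (a u).
Proof.
move=> bu b0; apply: (@eigenvalue_arrow _ _ (fun w => (w == u)%:R) _ u).
- by rewrite eqxx oner_neq0.
- have [u0|un0] := eqVneq u 0.
    by rewrite -u0 big1 ?addr0 1?mulrC// => w _; rewrite b0 ?mulr0.
  rewrite mul0r add0r mulr0 big1// => w _.
  by have [->|wu] := eqVneq w u; rewrite ?bu ?mulr0// mul0r.
- move=> w w0; have [->|wu] := eqVneq w u.
    by rewrite bu mulr0 add0r mulrC.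
  have [u0|un0] := eqVneq u 0; first by rewrite b0// !mulr0 mul0r addr0.
  by rewrite !mul0r mulr0 addr0.
Qed.

(** The last equation is the vanishing at [z] of the characteristic polynomial of the
    block in the rows [0] and [i]. *)
Lemma eigenvalue_leg1 (a b : 'I_n.+1 -> R) i z : i != 0 -> b i != 0 ->
  (forall u, u != i -> b u = 0) -> (z - a 0) * (z - a i) = b i ^+ 2 ->
  eigenvalue (real_arrow a b) z.
Proof.
move=> i0 bi bu E.
have i0' : (0 == i) = false by rewrite eq_sym (negPf i0).
apply: (@eigenvalue_arrow _ _ (fun u => if u == 0 then b i else
  if u == i then z - a 0 else 0) _ 0) => /=.
- by [].
- rewrite (bigD1 i)//= (negPf i0) eqxx big1 ?addr0 => [|u /andP[_ ui]].
    by ring.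
  by rewrite (bu u)// mulr0.
- move=> u u0; rewrite (negPf u0); have [->|ui] := eqVneq u i.
    by rewrite -expr2 -E; ring.
  by rewrite (bu u)// !mul0r !mulr0 addr0.
Qed.

(** The last equation is the vanishing at [z] of the characteristic polynomial of the
    block in the rows [0], [i], [j].  The eigenvector is solved from its entry [b i * b j]
    in the row [i]. *)
Lemma eigenvalue_leg2 (a b : 'I_n.+1 -> R) i j z :
  i != 0 -> j != 0 -> i != j -> b i != 0 -> b j != 0 ->
  (forall u, u != i -> u != j -> b u = 0) ->
  (z - a 0) * (z - a i) * (z - a j) = b i ^+ 2 * (z - a j) + b j ^+ 2 * (z - a i) ->
  eigenvalue (real_arrow a b) z.
Proof.
move=> i0 j0 ij bi bj bu E.
have ji : (j == i) = false by rewrite eq_sym (negPf ij).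
apply: (@eigenvalue_arrow _ _ (fun u => if u == 0 then (z - a i) * b j else
  if u == i then b i * b j else
  if u == j then (z - a 0) * (z - a i) - b i ^+ 2 else 0) _ i) => /=.
- by rewrite (negPf i0) eqxx mulf_neq0.
- rewrite (bigD1 i)//= (bigD1 j) ?j0 ?ji//= (negPf i0) (negPf j0) !eqxx.
  rewrite big1 ?addr0 => [|u /andP[/andP[_ ui] uj]]; first by ring.
  by rewrite (bu u)// mulr0.
- move=> u u0; rewrite (negPf u0); have [->|ui] := eqVneq u i; first by ring.
  have [->|uj] := eqVneq u j; last first.
    by rewrite (bu u)// !mul0r !mulr0 addr0.
  rewrite -[LHS]addr0 -(subrr ((z - a 0) * (z - a i) * (z - a j))) {2}E; ring.
Qed.

(** The characteristic polynomial has no room for a root besides [n.+1] distinct ones. *)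
Lemma spectrum_of_eigenvalues (lambda : 'I_n.+1 -> R) (A : 'M[R[i]]_n.+1) :
  injective lambda -> (forall i, eigenvalue A (lambda i)%:C%C) ->
  has_spectrum lambda A.
Proof.
move=> lamI lamA z; split=> [zA|[i ->] //].
apply: contrapT => zl; pose s := z :: [seq (lambda i)%:C%C | i : 'I_n.+1].
have := @max_poly_roots _ (char_poly A) s (monic_neq0 (char_poly_monic A)).
rewrite size_char_poly /s /= size_map size_enum_ord ltnn => H.
suff : false by []; apply: H.
  rewrite -eigenvalue_root_char zA; apply/allP => _ /mapP[i _ ->].
  rewrite -eigenvalue_root_char; exact: lamA.
rewrite map_inj_uniq ?enum_uniq => [|i j /(congr1 (@complex.Re R)) /lamI //].
by rewrite andbT; apply/mapP => -[i _ zi]; apply: zl; exists i.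
Qed.

Lemma isospectral_arrow_mx (lambda : 'I_n.+1 -> R) (s : 'I_n.+1 -> 'I_n.+1) a b :
  injective lambda -> injective s ->
  (forall u, eigenvalue (real_arrow a b) (lambda (s u))) ->
  isospectral_arrow lambda (arrow_mx a b).
Proof.
move=> lamI sI ev; split.
- apply/is_hermitianmxP; rewrite expr0 scale1r; apply/matrixP => u v.
  rewrite !mxE; apply: etrans (esym (conjc_real _)); congr (_%:C)%C; rewrite (eq_sym v).
  have [->//|uv] := eqVneq u v.
  have [u0|u0] := eqVneq u 0; have [v0|v0] := eqVneq v 0 => //.
  by rewrite u0 v0 eqxx in uv.
- by move=> u v uv u0 v0; rewrite !mxE (negPf uv) (negPf u0) (negPf v0).
- apply: spectrum_of_eigenvalues => // i.
  by rewrite -(f_invF sI i); have := ev (invF sI i); rewrite -(eigenvalue_map (real_complex R)).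
Qed.

Lemma continuous_arrow_mx (a b : R -> 'I_n.+1 -> R) :
  (forall u, continuous (a^~ u)) -> (forall u, continuous (b^~ u)) ->
  continuous (fun t => arrow_mx (a t) (b t)).
Proof.
move=> ca cb; apply: continuous_mx => u v.
under eq_fun do rewrite !mxE.
move=> t; apply: (@continuous_comp _ _ _ (fun t => if u == v then a t u else
  if v == 0 then b t u else if u == 0 then b t v else 0) (fun x : R => (x%:C)%C : R[i])).
  by case: (u == v); [exact: ca|case: (v == 0); [exact: cb|case: (u == 0); [exact: cb|exact: cst_continuous]]].
exact: continuous_real_complex.
Qed.

Lemma zero_legs_arrow_mx a b :
  zero_legs (arrow_mx a b) = [set k | b (lift 0 k) == 0]%SET.
Proof.
apply/setP => k; rewrite !inE !mxE /=.
by rewrite eq_complex /= eqxx andbT.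
Qed.

End RealArrow.

(** * Jacobi matrices of size three with prescribed spectrum *)

Section Jacobi.
Context {R : realType}.
Implicit Types x y z t : R.

(** The tridiagonal matrix with diagonal [ai, a0, aj] and off-diagonal entries
    [bi, bj] is the Jacobi matrix with spectrum [x, y, z] whose first basis vector
    has spectral weights proportional to [1, t ^ 2, t ^ 4]; the formulas are the
    output of the Lanczos process.  At [t = 0] it is the diagonal matrix of
    [x, y, z].  At [t = 1] the weights are equal, so that the matrix depends
    only on the set of the eigenvalues. *)
Definition jac_s t : R := 1 + t ^+ 2 + t ^+ 4.
Definition jac_k x y z t : R :=
  (x - y) ^+ 2 + t ^+ 2 * (x - z) ^+ 2 + t ^+ 4 * (y - z) ^+ 2.
Definition jac_vdm x y z : R := (x - y) ^+ 2 * (x - z) ^+ 2 * (y - z) ^+ 2.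

Definition jac_ai x y z t : R := (x + t ^+ 2 * y + t ^+ 4 * z) / jac_s t.
Definition jac_aj x y z t : R :=
  (z * (x - y) ^+ 2 + t ^+ 2 * (y * (x - z) ^+ 2) + t ^+ 4 * (x * (y - z) ^+ 2)) /
  jac_k x y z t.
Definition jac_a0 x y z t : R := x + y + z - jac_ai x y z t - jac_aj x y z t.
Definition jac_bi x y z t : R := t * (Num.sqrt (jac_k x y z t) / jac_s t).
Definition jac_bj x y z t : R :=
  t * (Num.sqrt (jac_vdm x y z * jac_s t) / jac_k x y z t).

Lemma jac_s_gt0 t : 0 < jac_s t.
Proof. by have := sqr_ge0 t; have := sqr_ge0 (t ^+ 2); rewrite /jac_s -exprM; lra. Qed.

Lemma jac_k_gt0 x y z t : x != y -> 0 < jac_k x y z t.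
Proof.
move=> xy; have xy0 : 0 < (x - y) ^+ 2 by rewrite exprn_even_gt0//= subr_eq0.
have := mulr_ge0 (sqr_ge0 t) (sqr_ge0 (x - z)).
have := mulr_ge0 (sqr_ge0 (t ^+ 2)) (sqr_ge0 (y - z)); rewrite -exprM /jac_k; lra.
Qed.

(** The characteristic polynomial of the Jacobi matrix vanishes at [x], [y] and [z]. *)
Lemma jac_char x y z t w : x != y -> y != z -> x != z -> w \in [:: x; y; z] ->
  (w - jac_a0 x y z t) * (w - jac_ai x y z t) * (w - jac_aj x y z t) =
  jac_bi x y z t ^+ 2 * (w - jac_aj x y z t) + jac_bj x y z t ^+ 2 * (w - jac_ai x y z t).
Proof.
move=> xy yz xz; have s0 := jac_s_gt0 t; have k0 := jac_k_gt0 z t xy.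
have v0 : 0 <= jac_vdm x y z.
  by apply: mulr_ge0; [apply: mulr_ge0|]; exact: sqr_ge0.
have -> : jac_bi x y z t ^+ 2 = t ^+ 2 * jac_k x y z t / jac_s t ^+ 2.
  by rewrite /jac_bi !exprMn sqr_sqrtr ?ltW// exprVn mulrA.
have -> : jac_bj x y z t ^+ 2 =
    t ^+ 2 * (jac_vdm x y z * jac_s t) / jac_k x y z t ^+ 2.
  have vs0 : 0 <= jac_vdm x y z * jac_s t by rewrite mulr_ge0// ltW.
  by rewrite /jac_bj 2!exprMn sqr_sqrtr// exprVn mulrA.
have {s0} s0 : jac_s t != 0 by rewrite gt_eqF.
have {k0} k0 : jac_k x y z t != 0 by rewrite gt_eqF.
move: s0 k0; rewrite /jac_a0 /jac_ai /jac_aj /jac_vdm /jac_s /jac_k => s0 k0.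
by rewrite !inE => /or3P[]/eqP ->; field; rewrite s0 exprMn k0.
Qed.

Lemma continuous_quadratic (x y : R) : continuous (fun t : R => x + t ^+ 2 * y).
Proof.
move=> t; apply: cvgD; first exact: cvg_cst.
by apply: cvgM; [exact: exprn_continuous|exact: cvg_cst].
Qed.

Lemma continuous_quartic (x y z : R) :
  continuous (fun t : R => x + t ^+ 2 * y + t ^+ 4 * z).
Proof.
move=> t; apply: cvgD; first exact: continuous_quadratic.
by apply: cvgM; [exact: exprn_continuous|exact: cvg_cst].
Qed.

Lemma continuous_divr (f g : R -> R) : continuous f -> continuous g ->
  (forall t, g t != 0) -> continuous (fun t => f t / g t).
Proof.
move=> cf cg g0 t; apply: cvgM; first exact: cf.
by apply: cvgV => //; exact: cg.
Qed.

Lemma continuous_jac_s : continuous jac_s.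
Proof.
rewrite (_ : jac_s = fun t => 1 + t ^+ 2 * 1 + t ^+ 4 * 1); first exact: continuous_quartic.
by apply/funext => t; rewrite /jac_s !mulr1.
Qed.

Lemma continuous_jac x y z : x != y ->
  [/\ continuous (jac_a0 x y z), continuous (jac_ai x y z), continuous (jac_aj x y z),
      continuous (jac_bi x y z) & continuous (jac_bj x y z)].
Proof.
move=> xy.
have s0 t : jac_s t != 0 by rewrite gt_eqF ?jac_s_gt0.
have k0 t : jac_k x y z t != 0 by rewrite gt_eqF ?jac_k_gt0.
have ck : continuous (jac_k x y z) by exact: continuous_quartic.
have ci : continuous (jac_ai x y z).
  by apply: continuous_divr => //; [exact: continuous_quartic|exact: continuous_jac_s].
have cj : continuous (jac_aj x y z).
  by apply: continuous_divr => //; exact: continuous_quartic.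
split=> //.
- move=> t; apply: cvgB; last exact: cj.
  by apply: cvgB; [exact: cvg_cst|exact: ci].
- move=> t; apply: cvgM; first by [].
  apply: (@continuous_divr (fun t => Num.sqrt (jac_k x y z t)) jac_s) => //.
    by move=> s; apply: (@continuous_comp _ _ _ (jac_k x y z) Num.sqrt); [exact: ck|exact: sqrt_continuous].
  exact: continuous_jac_s.
- move=> t; apply: cvgM; first by [].
  apply: (@continuous_divr (fun t => Num.sqrt (jac_vdm x y z * jac_s t)) (jac_k x y z)) => //.
  move=> s; apply: (@continuous_comp _ _ _ (fun t => jac_vdm x y z * jac_s t) Num.sqrt).
    by apply: cvgM; [exact: cvg_cst|exact: continuous_jac_s].
  exact: sqrt_continuous.
Qed.

End Jacobi.

(** * Edges and hexagons of the orbit space *)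

Section Centre.
Context {R : realType}.

(** The entries of the Jacobi matrix with three equal spectral weights. *)
Definition jac_center (x y z : R) :=
  (jac_a0 x y z 1, jac_ai x y z 1, jac_aj x y z 1, jac_bi x y z 1, jac_bj x y z 1).

Lemma jac_center_sym12 (x y z : R) : jac_center x y z = jac_center y x z.
Proof.
have ks : jac_k x y z 1 = jac_k y x z 1 by rewrite /jac_k !expr1n; ring.
have ais : jac_ai x y z 1 = jac_ai y x z 1.
  by rewrite /jac_ai; congr (_ / _); rewrite !expr1n; ring.
have js : jac_aj x y z 1 = jac_aj y x z 1.
  by rewrite /jac_aj ks; congr (_ / _); rewrite !expr1n; ring.
have vs : jac_vdm x y z = jac_vdm y x z by rewrite /jac_vdm; ring.
by rewrite /jac_center /jac_a0 /jac_bi /jac_bj ais js ks vs (addrC x y).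
Qed.

Lemma jac_center_sym23 (x y z : R) : jac_center x y z = jac_center x z y.
Proof.
have ks : jac_k x y z 1 = jac_k x z y 1 by rewrite /jac_k !expr1n; ring.
have ais : jac_ai x y z 1 = jac_ai x z y 1.
  by rewrite /jac_ai; congr (_ / _); rewrite !expr1n; ring.
have js : jac_aj x y z 1 = jac_aj x z y 1.
  by rewrite /jac_aj ks; congr (_ / _); rewrite !expr1n; ring.
have vs : jac_vdm x y z = jac_vdm x z y by rewrite /jac_vdm; ring.
by rewrite /jac_center /jac_a0 /jac_bi /jac_bj ais js ks vs (addrAC x y).
Qed.

Lemma jac_center_perm (x y z x' y' z' : R) :
  x' \in [:: x; y; z] -> y' \in [:: x; y; z] -> z' \in [:: x; y; z] ->
  x' != y' -> y' != z' -> x' != z' -> jac_center x' y' z' = jac_center x y z.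
Proof.
rewrite !inE => /or3P[]/eqP -> /or3P[]/eqP -> /or3P[]/eqP ->; rewrite ?eqxx// => _ _ _.
- by rewrite [LHS]jac_center_sym23.
- by rewrite [LHS]jac_center_sym12.
- by rewrite [LHS]jac_center_sym23 [LHS]jac_center_sym12.
- by rewrite [LHS]jac_center_sym12 [LHS]jac_center_sym23.
- by rewrite [LHS]jac_center_sym12 [LHS]jac_center_sym23 [LHS]jac_center_sym12.
Qed.

End Centre.

Section Curves.
Context {R : realType} {n : nat} (lambda : 'I_n.+1 -> R).
Context (lambda_inj : injective lambda).
Local Notation X := (isospectral_arrow lambda).

(** A curve of matrices that leaves [p], stays at positive times over the stratum of
    codimension [d] of the orbit space, and passes through [c]. *)
Definition stratum_path (d : nat) (p c : 'M[R[i]]_n.+1) : Prop :=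
  exists h : R -> 'M[R[i]]_n.+1,
    [/\ continuous h, forall t, X (h t),
        forall t, 0 < t -> #|zero_legs (h t)| = d, h 0 = p & h 1 = c].

Definition diag_arrow (mu : 'I_n.+1 -> R) := arrow_mx mu (fun=> 0).

(** The analogue of the Jacobi matrices for two eigenvalues, with spectral weights
    proportional to [1, t ^ 2]. *)
Definition edge_a (mu : 'I_n.+1 -> R) (i : 'I_n.+1) (t : R) : 'I_n.+1 -> R :=
  fun u => if u == 0 then (mu 0 + t ^+ 2 * mu i) / (1 + t ^+ 2)
           else if u == i then (mu i + t ^+ 2 * mu 0) / (1 + t ^+ 2)
           else mu u.

Definition edge_b (mu : 'I_n.+1 -> R) (i : 'I_n.+1) (t : R) : 'I_n.+1 -> R :=
  fun u => if u == i then t * (`|mu 0 - mu i| / (1 + t ^+ 2)) else 0.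

Definition edge_mx mu i t := arrow_mx (edge_a mu i t) (edge_b mu i t).

(** The Jacobi matrix of [mu i, mu 0, mu j], placed on the path of the legs [i] and
    [j] through [0]. *)
Definition hex_a (mu : 'I_n.+1 -> R) (i j : 'I_n.+1) (t : R) : 'I_n.+1 -> R :=
  fun u => if u == 0 then jac_a0 (mu i) (mu 0) (mu j) t
           else if u == i then jac_ai (mu i) (mu 0) (mu j) t
           else if u == j then jac_aj (mu i) (mu 0) (mu j) t else mu u.

Definition hex_b (mu : 'I_n.+1 -> R) (i j : 'I_n.+1) (t : R) : 'I_n.+1 -> R :=
  fun u => if u == i then jac_bi (mu i) (mu 0) (mu j) t
           else if u == j then jac_bj (mu i) (mu 0) (mu j) t else 0.

Definition hex_mx mu i j t := arrow_mx (hex_a mu i j t) (hex_b mu i j t).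

(** The two vertices of an edge are joined to the same midpoint. *)
Lemma edge_mx_sym mu mu' i : mu' 0 = mu i -> mu' i = mu 0 ->
  (forall u, u != 0 -> u != i -> mu' u = mu u) ->
  edge_mx mu' i 1 = edge_mx mu i 1.
Proof.
move=> e0 ei e; congr arrow_mx; apply/funext => u; rewrite /edge_a /edge_b.
  rewrite e0 ei !expr1n !mul1r; have [//|u0] := eqVneq u 0.
    by rewrite addrC.
  by have [//|ui] := eqVneq u i; [rewrite addrC|exact: e].
by rewrite e0 ei distrC.
Qed.

(** The six vertices of a hexagon are joined to the same centre. *)
Lemma hex_mx_sym mu mu' i j :
  mu' i \in [:: mu i; mu 0; mu j] -> mu' 0 \in [:: mu i; mu 0; mu j] ->
  mu' j \in [:: mu i; mu 0; mu j] ->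
  mu' i != mu' 0 -> mu' 0 != mu' j -> mu' i != mu' j ->
  (forall u, u != 0 -> u != i -> u != j -> mu' u = mu u) ->
  hex_mx mu' i j 1 = hex_mx mu i j 1.
Proof.
move=> hi h0 hj i0 j0 ij e.
have [e0 ei ej ebi ebj] := jac_center_perm hi h0 hj i0 j0 ij.
congr arrow_mx; apply/funext => u; rewrite /hex_a /hex_b ?e0 ?ei ?ej ?ebi ?ebj//.
by have [//|u0] := eqVneq u 0; have [//|ui] := eqVneq u i; have [//|uj] := eqVneq u j; exact: e.
Qed.

Section Labelled.
Context (s : 'I_n.+1 -> 'I_n.+1) (s_inj : injective s).
Let mu u := lambda (s u).

Lemma mu_neq u w : u != w -> mu u != mu w.
Proof. by apply: contraNneq => /lambda_inj/s_inj ->. Qed.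

Lemma diag_arrow_isospectral : X (diag_arrow mu).
Proof.
apply: (isospectral_arrow_mx lambda_inj s_inj) => u.
exact: (@eigenvalue_no_leg _ _ mu).
Qed.

Lemma edge_den_gt0 (t : R) : 0 < 1 + t ^+ 2.
Proof. by have := sqr_ge0 t; lra. Qed.

Lemma edge_mx0 i : edge_mx mu i 0 = diag_arrow mu.
Proof.
congr arrow_mx; apply/funext => u; rewrite /edge_a /edge_b.
  rewrite !expr0n /= !mul0r !addr0 !divr1.
  by case: eqP => [->//|_]; case: eqP => [->|].
by rewrite mul0r if_same.
Qed.

Lemma hex_mx0 i j : i != 0 -> i != j -> hex_mx mu i j 0 = diag_arrow mu.
Proof.
move=> i0 ij; congr arrow_mx; apply/funext => u; rewrite /hex_a /hex_b.
  have xy : (mu i - mu 0) ^+ 2 != 0 by rewrite sqrf_eq0 subr_eq0 mu_neq.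
  have ei : jac_ai (mu i) (mu 0) (mu j) 0 = mu i.
    by rewrite /jac_ai /jac_s !expr0n /= !mul0r !addr0 divr1.
  have ej : jac_aj (mu i) (mu 0) (mu j) 0 = mu j.
    by rewrite /jac_aj /jac_k !expr0n /= !mul0r !addr0 mulfK.
  rewrite /jac_a0 ei ej.
  have [->|u0] := eqVneq u 0; first by ring.
  by case: eqP => [->//|_]; case: eqP => [->|].
by rewrite /jac_bi /jac_bj !mul0r !if_same.
Qed.

Lemma path_edge i : i != 0 -> stratum_path n.-1 (diag_arrow mu) (edge_mx mu i 1).
Proof.
move=> i0; exists (edge_mx mu i); split=> // [|t|t t0|]; last exact: edge_mx0.
- have den (t : R) : 1 + t ^+ 2 != 0 by rewrite gt_eqF ?edge_den_gt0.
  have cden : continuous (fun t : R => 1 + t ^+ 2).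
    by under eq_fun do rewrite -[_ ^+ 2]mulr1; exact: continuous_quadratic.
  apply: continuous_arrow_mx => u; rewrite /edge_a /edge_b.
    case: (u == 0).
      by apply: (continuous_divr (f := fun t => mu 0 + t ^+ 2 * mu i)) => //; exact: continuous_quadratic.
    case: (u == i) => [|t]; last exact: cvg_cst.
    by apply: (continuous_divr (f := fun t => mu i + t ^+ 2 * mu 0)) => //; exact: continuous_quadratic.
  case: (u == i) => t; last exact: cvg_cst.
  apply: cvgM; first by [].
  apply: (@continuous_divr _ (fun=> `|mu 0 - mu i|) (fun t => 1 + t ^+ 2)) => //.
  by move=> ?; exact: cvg_cst.
- have [->|t0] := eqVneq t 0; first by rewrite edge_mx0; exact: diag_arrow_isospectral.
  apply: (isospectral_arrow_mx lambda_inj s_inj) => u; rewrite -/(mu u).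
  have den : 1 + t ^+ 2 != 0 by rewrite gt_eqF ?edge_den_gt0.
  have m0i : mu 0 - mu i != 0 by rewrite subr_eq0 mu_neq// eq_sym.
  have leg w : (w == 0) || (w == i) -> eigenvalue (real_arrow (edge_a mu i t) (edge_b mu i t)) (mu w).
    move=> wi; apply: (@eigenvalue_leg1 _ _ _ _ i) => //.
    - by rewrite /edge_b eqxx mulf_neq0// mulf_neq0 ?invr_eq0 ?normr_eq0.
    - by move=> v /negPf vi; rewrite /edge_b vi.
    rewrite /edge_a /edge_b !eqxx (negPf i0) exprMn expr_div_n real_normK ?num_real//.
    by case/orP: wi => /eqP ->; field.
  have [u0|u0] := eqVneq u 0; first by apply: leg; rewrite u0 eqxx.
  have [ui|ui] := eqVneq u i; first by apply: leg; rewrite ui eqxx orbT.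
  rewrite -[mu u](_ : edge_a mu i t u = _); last by rewrite /edge_a (negPf u0) (negPf ui).
  apply: eigenvalue_no_leg => [|u0']; first by rewrite /edge_b (negPf ui).
  by rewrite u0' eqxx in u0.
- have [k ik] : exists k : 'I_n, i = lift 0 k by case: (unliftP 0 i) i0 => [k -> _|->]; [exists k|rewrite eqxx].
  have m0i : mu 0 - mu i != 0 by rewrite subr_eq0 mu_neq// eq_sym.
  rewrite zero_legs_arrow_mx (_ : [set l | _]%SET = [set~ k]%SET).
    by rewrite cardsC1 card_ord.
  apply/setP => l; rewrite !inE /edge_b ik (inj_eq lift_inj).
  have [_|_] := eqVneq l k; last by rewrite eqxx.
  rewrite -ik; apply/negbTE/mulf_neq0; first by rewrite gt_eqF.
  by apply: mulf_neq0; rewrite ?normr_eq0// invr_eq0 gt_eqF ?edge_den_gt0.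
Qed.

Lemma path_hex i j : i != 0 -> j != 0 -> i != j ->
  stratum_path n.-2 (diag_arrow mu) (hex_mx mu i j 1).
Proof.
move=> i0 j0 ij; exists (hex_mx mu i j).
have xy : mu i != mu 0 by exact: mu_neq.
have yz : mu 0 != mu j by rewrite mu_neq// eq_sym.
have xz : mu i != mu j by exact: mu_neq.
have ji : (j == i) = false by rewrite eq_sym (negPf ij).
have bi0 t : t != 0 -> hex_b mu i j t i != 0.
  move=> t0; rewrite /hex_b eqxx !mulf_neq0 ?invr_eq0 ?(gt_eqF (jac_s_gt0 _))//.
  by rewrite gt_eqF// sqrtr_gt0 jac_k_gt0.
have bj0 t : t != 0 -> hex_b mu i j t j != 0.
  move=> t0; rewrite /hex_b ji eqxx !mulf_neq0 ?invr_eq0 ?(gt_eqF (jac_k_gt0 _ _ xy))//.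
  rewrite gt_eqF// sqrtr_gt0 mulr_gt0 ?jac_s_gt0// /jac_vdm.
  have sq (a c : R) : a != c -> 0 < (a - c) ^+ 2.
    by move=> ac; rewrite exprn_even_gt0//= subr_eq0.
  by apply: mulr_gt0; [apply: mulr_gt0|]; exact: sq.
split=> // [|t|t t0|]; last exact: hex_mx0.
- have [c0 ci cj cbi cbj] := continuous_jac (mu j) xy.
  apply: continuous_arrow_mx => u; rewrite /hex_a /hex_b.
    case: (u == 0) => //; case: (u == i) => //; case: (u == j) => // t; exact: cvg_cst.
  by case: (u == i) => //; case: (u == j) => // t; exact: cvg_cst.
- have [->|t0] := eqVneq t 0; first by rewrite hex_mx0//; exact: diag_arrow_isospectral.
  apply: (isospectral_arrow_mx lambda_inj s_inj) => u; rewrite -/(mu u).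
  have leg w : mu w \in [:: mu i; mu 0; mu j] ->
      eigenvalue (real_arrow (hex_a mu i j t) (hex_b mu i j t)) (mu w).
    move=> hw; apply: (@eigenvalue_leg2 _ _ _ _ i j) => //; try by [exact: bi0|exact: bj0].
      by move=> v /negPf vi /negPf vj; rewrite /hex_b vi vj.
    rewrite /hex_a /hex_b !eqxx (negPf i0) (negPf j0) ji.
    exact: jac_char.
  have [u0|u0] := eqVneq u 0; first by apply: leg; rewrite u0 !inE eqxx orbT.
  have [ui|ui] := eqVneq u i; first by apply: leg; rewrite ui !inE eqxx.
  have [uj|uj] := eqVneq u j; first by apply: leg; rewrite uj !inE eqxx !orbT.
  rewrite -[mu u](_ : hex_a mu i j t u = _); last by rewrite /hex_a (negPf u0) (negPf ui) (negPf uj).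
  apply: eigenvalue_no_leg => [|u0']; first by rewrite /hex_b (negPf ui) (negPf uj).
  by rewrite u0' eqxx in u0.
- have lifted w : w != 0 -> exists k : 'I_n, w = lift 0 k.
    by case: (unliftP 0 w) => [k -> _|->]; [exists k|rewrite eqxx].
  have [k ik] := lifted i i0; have [l jl] := lifted j j0.
  have kl : k != l by apply: contraNneq ij => kl; rewrite ik jl kl.
  rewrite zero_legs_arrow_mx (_ : [set l | _]%SET = (~: [set k; l])%SET).
    by rewrite cardsCs finset.setCK cards2 kl card_ord subn2.
  apply/setP => w; rewrite !inE.
  have [->|wk] := eqVneq w k; first by rewrite -ik; apply/negbTE/bi0; rewrite gt_eqF.
  have [->|wl] := eqVneq w l; first by rewrite -jl; apply/negbTE/bj0; rewrite gt_eqF.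
  by rewrite /hex_b ik jl !(inj_eq lift_inj) (negPf wk) (negPf wl) eqxx.
Qed.

End Labelled.
End Curves.

(** * Images of the fixed points in a simple polytope *)

Lemma exists_nonroot (R : realDomainType) (p : {poly R}) :
  p != 0 -> exists t, p.[t] != 0.
Proof.
move=> p0; apply: contrapT => h.
have := @max_poly_roots _ p [seq k%:R | k <- iota 0 (size p)] p0.
rewrite size_map size_iota ltnn => H; suff : false by []; apply: H.
  apply/allP => x _; apply/negPn/negP => px; apply: h; by exists x.
by rewrite map_inj_uniq ?iota_uniq// => i j /eqP; rewrite eqr_nat => /eqP.
Qed.

(** Read vectors as polynomials, and evaluate them at a point that is not a root of the
    difference of any two of them. *)
Lemma separating_functional (R : realDomainType) (n : nat) (T : finType)
    (p : T -> 'rV[R]_n) : injective p ->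
  exists g : {linear 'rV[R]_n -> R^o}, forall s t, s != t -> g (p s) != g (p t).
Proof.
move=> pI.
have [|x] := @exists_nonroot R
    (\prod_(st : T * T | st.1 != st.2) rVpoly (p st.1 - p st.2)).
  apply/prodf_neq0 => -[s t] /= st; apply: contraNneq st => e.
  by apply/eqP/pI/eqP; rewrite -subr_eq0 -[p s - p t]rVpolyK e linear0.
rewrite horner_prod => /prodf_neq0 h.
exists ((horner_eval x : {poly R} -> R^o) \o (@rVpoly R n)) => s t st.
by have := h (s, t) st; rewrite /= linearB /= hornerD hornerN subr_eq0.
Qed.

Section Ext.
Context {n : nat} (n_ge3 : (3 <= n)%N).

(** The positions [0, 1, 2, 3], in which the eigenvalues are permuted while the others
    stay in place. *)
Definition emb (a : 'I_4) : 'I_n.+1 := widen_ord (n_ge3 : (4 <= n.+1)%N) a.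

Definition ext_perm (s : {perm 'I_4}) (u : 'I_n.+1) : 'I_n.+1 :=
  if insub (val u) is Some a then emb (s a) else u.

Lemma emb_inj : injective emb.
Proof. by move=> a b /(congr1 val) /= ab; exact: val_inj. Qed.

Lemma emb_ord0 : emb ord0 = 0.
Proof. exact: val_inj. Qed.

Lemma ext_emb s a : ext_perm s (emb a) = emb (s a).
Proof. by rewrite /ext_perm /= valK. Qed.

Lemma ext_out s u : (forall a, u != emb a) -> ext_perm s u = u.
Proof.
move=> h; rewrite /ext_perm; case: insubP => // a _ au.
by have := h a; rewrite (_ : emb a = u) ?eqxx//; exact: val_inj.
Qed.

Variant ext_spec (u : 'I_n.+1) : Prop :=
  | ExtIn a of u = emb a | ExtOut of (forall a, u != emb a).

Lemma extP u : ext_spec u.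
Proof.
have [[a ua]|h] := pselect (exists a, u = emb a); first exact: ExtIn ua.
by apply: ExtOut => a; apply/eqP => ua; apply: h; exists a.
Qed.

Lemma ext_inj s : injective (ext_perm s).
Proof.
move=> u v; case: (extP u) => [a ->|hu]; case: (extP v) => [b ->|hv].
- by rewrite !ext_emb => /emb_inj/perm_inj ->.
- by rewrite ext_emb (ext_out _ hv) => e; have := hv (s a); rewrite e eqxx.
- by rewrite ext_emb (ext_out _ hu) => e; have := hu (s b); rewrite e eqxx.
- by rewrite !ext_out.
Qed.

End Ext.

Section Assembly.
Context {R : realType} {n' m : nat}.
Local Notation n := n'.+1.
Context (lambda : 'I_n.+1 -> R) (L : 'M[R]_(n, m)) (b : 'rV[R]_m).
Local Notation X := (isospectral_arrow lambda).
Local Notation act := (arrow_action lambda).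
Local Notation P := (halfspaces L b).
Context (f : orbit_space act -> P).
Context (lambda_inj : injective lambda) (n_ge3 : (3 <= n)%N).
Context (mfd : manifold_with_corners (orbit_atlas act)) (sP : simple_polytope P).
Context (hf : corner_homeo (orbit_atlas act) (polytope_atlas P) f).

Definition image_point (x : X) : 'rV[R]_n := set_val (f (orbit_proj act x)).
Local Notation active := (active L b).
Local Notation face_codim := (face_codim L b).

Lemma image_pointP x : P (image_point x).
Proof. exact: set_valP. Qed.

Lemma image_point_codim x : face_codim #|zero_legs (set_val x)| (image_point x).
Proof.
have [_ _ _ cover _] := mfd; have [_ _ codim_eq] := hf.
have [c Ac cx] := cover (orbit_proj act x).
move=> v I fI xv; rewrite -(orbit_chart_codim Ac cx).
rewrite (codim_eq c (frame_chart L b v I) _ Ac)//; last exact: frame_chart_atlas.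
by rewrite frame_chart_codim.
Qed.

(** Along the image of the path the codimension is constant for positive times, so
    [active_path] applies. *)
Lemma image_point_path d (p c : X) : stratum_path lambda d (set_val p) (set_val c) ->
  active (image_point c) \subset active (image_point p).
Proof.
move=> [h [ch Xh hd h0 h1]].
pose hX t : X := exist _ (h t) (mem_set (Xh t)).
have chX : continuous hX.
  apply/continuousP => _ [V oV <-].
  exact: (open_comp (f := h) (fun t _ => ch t) oV).
have e0 : hX 0 = p by exact: val_inj.
have e1 : hX 1 = c by exact: val_inj.
rewrite -e0 -e1; apply: (@active_path _ _ _ _ _ d (fun t => image_point (hX t)) sP).
- have [cf _ _] := hf.
  move=> t; apply: (@continuous_comp _ _ _ (fun t => f (orbit_proj act (hX t))) set_val);
    last exact: initial_continuous.
  apply: (@continuous_comp _ _ _ (fun t => orbit_proj act (hX t)) f); last exact: cf.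
  apply: (@continuous_comp _ _ _ hX (orbit_proj act)); first exact: chX.
  exact: pi_continuous.
- by move=> t; exact: image_pointP.
- by move=> t t0; rewrite -(hd t t0); exact: image_point_codim.
Qed.

(** The action does not change the diagonal entries, so distinct diagonal matrices are
    in distinct orbits. *)
Lemma image_point_diag (x y : X) (mu mu' : 'I_n.+1 -> R) :
  set_val x = diag_arrow mu -> set_val y = diag_arrow mu' ->
  image_point x = image_point y -> mu = mu'.
Proof.
move=> xE yE /val_inj; have [_ [g [fK _] _] _] := hf.
move=> /(can_inj fK)/eqmodP/asboolP[t Tt].
rewrite xE yE => /matrixP e; apply/funext => u; have := e u u.
rewrite /= diag_conjE; last exact: torus_section_torus.
have t0 : torus_section t 0 u != 0.
  by rewrite -normr_eq0 (torus_section_torus Tt) oner_neq0.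
by rewrite mulrAC divff// mul1r !mxE eqxx => -[].
Qed.

Definition vertex_label (s : {perm 'I_4}) (u : 'I_n.+1) : R := lambda (ext_perm n_ge3 s u).

Definition diag_point (s : {perm 'I_4}) : X :=
  exist _ (diag_arrow (vertex_label s))
    (mem_set (diag_arrow_isospectral lambda_inj (@ext_inj _ n_ge3 s))).

Definition vtx s := image_point (diag_point s).

Lemma diag_pointE s : set_val (diag_point s) = diag_arrow (vertex_label s).
Proof. by rewrite set_valE. Qed.

Lemma vtx_inj : injective vtx.
Proof.
move=> s t /(image_point_diag (diag_pointE s) (diag_pointE t)) e; apply/permP => a.
have := congr1 (@^~ (emb n_ge3 a)) e; rewrite /vertex_label !ext_emb.
by move=> /lambda_inj/emb_inj.
Qed.

Lemma vtx_codim s : face_codim n (vtx s).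
Proof.
have := @image_point_codim (diag_point s).
rewrite (_ : #|_| = n)// -[RHS](card_ord n) -cardsT; congr #|pred_of_set _|.
by rewrite diag_pointE zero_legs_arrow_mx; apply/setP => k; rewrite !inE eqxx.
Qed.

Lemma path_end d p c : stratum_path lambda d p c -> X c.
Proof. by move=> [h [_ Xh _ _ <-]]. Qed.

Lemma path_end_codim d p c : stratum_path lambda d p c -> #|zero_legs c| = d.
Proof. by move=> [h [_ _ hd _ <-]]; exact: hd. Qed.

Lemma emb_neq0 i : i != ord0 -> emb n_ge3 i != 0.
Proof. by rewrite -(emb_ord0 n_ge3) (inj_eq (@emb_inj _ n_ge3)). Qed.

(** The witness is the midpoint of the edge, at the end of the two paths [path_edge]. *)
Lemma vtx_edge s i : i != ord0 -> exists e, [/\ face_codim n.-1 e,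
  active e \subset active (vtx s) & active e \subset active (vtx (flip s i))].
Proof.
move=> i0; have ei0 := emb_neq0 i0.
have a1 := path_edge lambda_inj (@ext_inj _ n_ge3 s) ei0.
have := path_edge lambda_inj (@ext_inj _ n_ge3 (flip s i)) ei0.
rewrite (@edge_mx_sym _ _ (vertex_label s)) => [a2||| u u0 ui]; first last.
- rewrite /vertex_label; case: (extP n_ge3 u) u0 ui => [a ->|hu _ _]; last by rewrite !ext_out.
  rewrite -(emb_ord0 n_ge3) !(inj_eq (@emb_inj _ n_ge3)) !ext_emb flipE => a0 ai.
  by rewrite tpermD// eq_sym.
- by rewrite /vertex_label ext_emb flipE tpermR -(emb_ord0 n_ge3) ext_emb.
- by rewrite /vertex_label -(emb_ord0 n_ge3) !ext_emb flipE tpermL.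
pose c : X := exist _ (edge_mx (vertex_label s) (emb n_ge3 i) 1) (mem_set (path_end a1)).
exists (image_point c); split.
- by rewrite -(path_end_codim a1); exact: image_point_codim.
- exact: (@image_point_path _ (diag_point s) c a1).
- exact: (@image_point_path _ (diag_point (flip s i)) c a2).
Qed.

Lemma ord4_cover (i j k a : 'I_4) : i != ord0 -> j != ord0 -> k != ord0 ->
  i != j -> i != k -> j != k -> a != k -> [|| a == i, a == ord0 | a == j].
Proof.
case: i j k a => [i hi] [j hj] [k hk] [a ha]; rewrite -!val_eqE /=; lia.
Qed.

(** The witness is the centre of the hexagon, at the end of the six paths [path_hex]. *)
Lemma vtx_hexagon (s : {perm 'I_4}) i j k : i != ord0 -> j != ord0 -> k != ord0 ->
  i != j -> i != k -> j != k ->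
  exists c, face_codim n.-2 c /\
    forall t : {perm 'I_4}, s k = t k -> active c \subset active (vtx t).
Proof.
move=> i0 j0 k0 ij ik jk; have ei0 := emb_neq0 i0; have ej0 := emb_neq0 j0.
have eij : emb n_ge3 i != emb n_ge3 j by rewrite (inj_eq (@emb_inj _ n_ge3)).
have a1 := path_hex lambda_inj (@ext_inj _ n_ge3 s) ei0 ej0 eij.
pose c : X := exist _ (hex_mx (vertex_label s) (emb n_ge3 i) (emb n_ge3 j) 1)
  (mem_set (path_end a1)).
exists (image_point c); split.
  by rewrite -(path_end_codim a1); exact: image_point_codim.
move=> t st; apply: (@image_point_path n.-2 (diag_point t) c).
have := path_hex lambda_inj (@ext_inj _ n_ge3 t) ei0 ej0 eij.
have lab a : a != k -> vertex_label t (emb n_ge3 a) \in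
    [:: vertex_label s (emb n_ge3 i); vertex_label s (emb n_ge3 ord0); vertex_label s (emb n_ge3 j)].
  move=> ak; pose a' := (s^-1)%g (t a).
  have sa : s a' = t a by rewrite permKV.
  have a'k : a' != k by apply: contraNneq ak => a'k; apply/eqP/(@perm_inj _ t); rewrite -st -a'k sa.
  rewrite /vertex_label !ext_emb -sa !inE.
  by case/or3P: (ord4_cover i0 j0 k0 ij ik jk a'k) => /eqP ->; rewrite eqxx ?orbT.
have neq a a' : a != a' -> vertex_label t (emb n_ge3 a) != vertex_label t (emb n_ge3 a').
  move=> aa; apply: (mu_neq lambda_inj (@ext_inj _ n_ge3 t)).
  by rewrite (inj_eq (@emb_inj _ n_ge3)).
rewrite (@hex_mx_sym _ _ (vertex_label s))//; rewrite -?(emb_ord0 n_ge3).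
- by apply: lab.
- by apply: lab; rewrite eq_sym.
- by apply: lab.
- exact: neq.
- by apply: neq; rewrite eq_sym.
- exact: neq.
- move=> u; case: (extP n_ge3 u) => [a ->|hu _ _ _]; last by rewrite /vertex_label !ext_out.
  rewrite !(inj_eq (@emb_inj _ n_ge3)) => a0 ai aj.
  have -> : a = k.
    apply/eqP; apply: contrapT => /negP/(ord4_cover i0 j0 k0 ij ik jk).
    by rewrite (negPf a0) (negPf ai) (negPf aj).
  by rewrite /vertex_label !ext_emb st.
Qed.

Lemma flip_neq s i j : i != j -> flip s i != flip s j.
Proof.
move=> ij; apply: contraNneq ij => /permP/(_ ord0).
by rewrite !flipE !tpermL => /perm_inj ->.
Qed.

Lemma flip_neq_self s i : i != ord0 -> flip s i != s.
Proof.
by apply: contraNneq => /permP/(_ ord0); rewrite flipE tpermL => /perm_inj ->.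
Qed.

(** The hexagon is contained in the cone spanned by its two edges at the vertex [s]. *)
Lemma vtx_cone (s t : {perm 'I_4}) i j k : i != ord0 -> j != ord0 -> k != ord0 ->
  i != j -> i != k -> j != k -> s k = t k ->
  exists r1 r2, [/\ 0 <= r1, 0 <= r2 &
    vtx t = vtx s + r1 *: (vtx (flip s i) - vtx s) + r2 *: (vtx (flip s j) - vtx s)].
Proof.
move=> i0 j0 k0 ij ik jk st.
have [e1 [de1 e1s e1i]] := vtx_edge s i0; have [e2 [de2 e2s e2j]] := vtx_edge s j0.
have [c [dc ct]] := vtx_hexagon s i0 j0 k0 ij ik jk.
have flipk a : a != k -> s k = flip s a k by move=> ak; rewrite flipE tpermD// eq_sym.
have n2 : (2 <= n)%N by exact: ltnW.
apply: (vertex_cone sP _ _ (And3 de1 de2 dc) n2 _ e1i e2j); split=> //;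
  try exact: image_pointP; try exact: vtx_codim.
- exact: ct.
- by apply: ct; exact: flipk.
- by apply: ct; exact: flipk.
- exact: ct.
- by move/vtx_inj/eqP; rewrite (negPf (flip_neq_self s i0)).
- by move/vtx_inj/eqP; rewrite (negPf (flip_neq_self s j0)).
- by move/vtx_inj/eqP; rewrite (negPf (flip_neq s ij)).
Qed.

(** By [vtx_cone] a generic functional increases from a local minimum of a hexagon to
    all its other vertices, and similarly for local maxima, which is what
    [no_hexagonal_sphere] excludes. *)
Lemma no_corner_homeo : False.
Proof.
have [g gne] := separating_functional vtx_inj.
apply: (@no_hexagonal_sphere R (fun s => g (vtx s))) => [s i i0|e k s t k0 st nst hs].
  by apply: gne; exact: flip_neq_self.
have [i [j [i0 j0 ij ik jk]]] : exists i j : 'I_4,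
    [/\ i != ord0, j != ord0, i != j, i != k & j != k].
  case: k k0 {st hs} => [[|[|[|[|]]]] // hk] _.
  - by exists (@Ordinal 4 2 isT), (@Ordinal 4 3 isT).
  - by exists (@Ordinal 4 1 isT), (@Ordinal 4 3 isT).
  - by exists (@Ordinal 4 1 isT), (@Ordinal 4 2 isT).
have [r1 [r2 [r10 r20 tE]]] := vtx_cone i0 j0 k0 ij ik jk st.
have hi := hs i i0 ik; have hj := hs j j0 jk.
have E : (-1) ^+ e * (g (vtx t) - g (vtx s)) =
    r1 * ((-1) ^+ e * (g (vtx (flip s i)) - g (vtx s))) +
    r2 * ((-1) ^+ e * (g (vtx (flip s j)) - g (vtx s))).
  have gD x y : g (x + y) = g x + g y := linearD g x y.
  have gZ r x : g (r *: x) = r * g x := linearZ_LR g r x.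
  have gB x y : g (x - y) = g x - g y := linearB g x y.
  by rewrite {1}tE !gD !gZ !gB; ring.
rewrite lt_neqAle; apply/andP; split; last by rewrite E addr_ge0// mulr_ge0// ltW.
by rewrite eq_sym mulf_neq0 ?signr_eq0// subr_eq0 gne// eq_sym.
Qed.

End Assembly.

Theorem mainTheorem4 (R : realType) (n : nat) (lambda : 'I_n.+1 -> R)
    (n_ge3 : (3 <= n)%N)
    (lambda_lt : forall i j : 'I_n.+1, (i < j)%N -> lambda i < lambda j) :
  ~ is_simple_polytope (orbit_atlas (arrow_action lambda)) /\
  ~ quasitoric (arrow_action lambda).
Proof.
have lambda_inj : injective lambda.
  move=> i j e; apply/val_inj.
  by case: (ltngtP (val i) (val j)) => // /lambda_lt; rewrite e ltxx.
suff H : ~ is_simple_polytope (orbit_atlas (arrow_action lambda)).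
  by split=> // -[_ _ _]; exact: H.
case: n lambda n_ge3 lambda_inj {lambda_lt} => [//|n'] lambda n_ge3 lambda_inj.
move=> [mfd [P [f [sP hf]]]].
have [[[m [L [b PE]]] _ _] _] := sP; subst P.
exact: (no_corner_homeo lambda_inj n_ge3 mfd sP hf).
Qed.
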